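(* Let $\phi=(\phi_i)_{i\ge1}:\overline{\mathbb{D}}^\infty\to\overline{\mathbb{D}}^\infty$ be a map such that $C_\phi f=f\circ\phi$ maps $A^+(\mathbb{T}^\infty)$ into itself, and such that moreover $\phi(\mathbb{T}^\infty)\subseteq\mathbb{T}^\infty$. Then: (a) There exist a matrix $A=(a_{ij})_{i,j\ge1}$ with $a_{ij}\in\mathbb{N}_0$ and $\sum_ja_{ij}<\infty$ for each $i$, and complex numbers $\epsilon_i$ of modulus $1$, such that $\phi_i(z)=\epsilon_i\prod_{j\ge1}z_j^{a_{ij}}$ for $i=1,2,\dots$. (b) $C_\phi$ is an isometry of $A^+(\mathbb{T}^\infty)$ if and only if the map $A^*:\mathbb{Z}^{(\infty)}\to\mathbb{Z}^{(\infty)}$, $A^*(\alpha)=\gamma$ with $\gamma_j=\sum_{i\ge1}a_{ij}\alpha_i$, is injective.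
   Context: $A^+(\mathbb{T}^\infty)$ is the algebra of functions $f(z)=\sum_\alpha a_\alpha z^\alpha$ on $\overline{\mathbb{D}}^\infty$, $\alpha$ ranging over $\mathbb{N}_0^{(\infty)}$ (finitely supported sequences of non-negative integers), $z^\alpha=\prod_jz_j^{\alpha_j}$, with $\|f\|=\sum|a_\alpha|<\infty$; a Banach algebra under pointwise multiplication. $\mathbb{T}^\infty$ is the set of sequences of complex numbers of modulus $1$. $\mathbb{Z}^{(\infty)}$ is the set of finitely supported integer sequences. *)

(* Defs.v *)
From HB Require Import structures.
From mathcomp Require Import all_boot all_order all_algebra.
From mathcomp Require Import finmap.
From mathcomp Require Import complex.
From mathcomp Require Import reals.

Set Implicit Arguments.
Unset Strict Implicit.
Unset Printing Implicit Defensive.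

Import Order.TTheory GRing.Theory Num.Theory.
Local Open Scope ring_scope.
Local Open Scope fset_scope.

(* N_0^(infty): finitely supported sequences of non-negative integers
   (indices j = 0,1,2,... correspond to the paper's j = 1,2,3,...). *)
Definition mindex := {fsfun nat -> nat with 0%N}.

Definition zindex := {fsfun nat -> int with 0%Z}.

Section Defs.
Variable R : realType.
Local Notation C := R[i].

Definition cseq := nat -> C.

Definition in_polydisc (z : cseq) : Prop := forall j, `|z j| <= 1.
Definition in_torus (z : cseq) : Prop := forall j, `|z j| = 1.

Definition zpow (z : cseq) (al : mindex) : C :=
  \prod_(j <- finsupp al) z j ^+ al j.

Definition abs_summable (a : mindex -> C) : Prop :=
  exists M : R, forall F : {fset mindex}, \sum_(al <- F) `|a al| <= (M%:C)%C.

Definition has_sum (f : mindex -> C) (s : C) : Prop :=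
  forall e : R, 0 < e -> exists F0 : {fset mindex},
    forall F : {fset mindex}, F0 `<=` F ->
      `|s - \sum_(al <- F) f al| < (e%:C)%C.

Definition is_coeffs (a : mindex -> C) (f : cseq -> C) : Prop :=
  abs_summable a /\
  forall z, in_polydisc z -> has_sum (fun al => a al * zpow z al) (f z).

(* f belongs to A^+(T^infty) (f is a function on \bar D^infty;
   values outside the polydisc are irrelevant) *)
Definition in_Aplus (f : cseq -> C) : Prop := exists a, is_coeffs a f.

Definition Aplus_norm_is (f : cseq -> C) (n : R) : Prop :=
  exists a, is_coeffs a f /\ has_sum (fun al => `|a al|) (n%:C)%C.

Definition comp_op (phi : cseq -> cseq) (f : cseq -> C) : cseq -> C :=
  fun z => f (phi z).

Definition comp_isometry (phi : cseq -> cseq) : Prop :=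
  forall (f : cseq -> C) (n : R),
    Aplus_norm_is f n -> Aplus_norm_is (comp_op phi f) n.

End Defs.

Definition Astar (A : nat -> mindex) (al : zindex) : nat -> int :=
  fun j => \sum_(i <- finsupp al) ((A i j)%:Z * al i)%R.

(* Main.v *)
(**
Write [g = phi_i] and suppose that two coefficients of [g] are non-zero.
Restricting [g] to a curve [x |-> (x ^ (N ^ j))_j] gives a function [h] on the
circle, a uniform limit of polynomials, that is not a monomial.  Comparing lowest
coefficients, no cross difference
[h(x^(j+l+1)) h(x^(j'+l'+1)) - h(x^(j'+l+1)) h(x^(j+l'+1))] with [j <> j'] and
[l <> l'] vanishes identically, so one [x] on the circle makes them all non-zero.
For the unimodular [L x L] matrix [u_(jl) = h(x^(j+l+1))], the entrywise powers
[V = (u_(jl)^n)] then have on average over [n] a trace of [(V^* V)^2] of order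
[L^3], hence for some large [n] an operator norm [O(L^(3/4))].  Pairing with
[conj V] is a functional of size [O(L^(7/4))] on the unit ball of [A^+] which takes
the value [L^2] on [g^n]: so the norms of the [g^n] are unbounded, and a gliding
hump gives [f(z) = sum_k 4^(-k) z_i^(n_k)] with [f o phi] outside [A^+].  Thus
[phi_i] is a unimodular multiple of a monomial.

Then [C_phi] maps [z^al] to a unimodular multiple of [z^(A^* al)].  If [A^*] is
injective it moves coefficients without merging them; if not, two distinct
monomials, suitably normalized, have a difference of norm 2 that [C_phi] kills.
*)
Require Import Defs.
From HB Require Import structures.
From mathcomp Require Import all_boot all_order all_algebra.
From mathcomp Require Import cyclic separable cyclotomic.
From mathcomp Require Import boolp classical_sets.
From mathcomp Require Import finmap complex reals.
From mathcomp Require Import ring lra zify.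
Set Implicit Arguments.
Unset Strict Implicit.
Unset Printing Implicit Defensive.

Import Order.TTheory GRing.Theory Num.Theory.
Import ComplexField.Normc.
Local Open Scope ring_scope.

(** * Moduli and unordered sums *)

Section Modulus.
Variable R : realType.
Local Notation C := R[i].
Implicit Types x y z : C.

Lemma normr_normc z : `|z| = (normc z)%:C%C.
Proof. by []. Qed.

Lemma normc_ge0 z : 0 <= normc z.
Proof. by rewrite -lecR -normr_normc normr_ge0. Qed.

Lemma normc_sub z : normc (- z) = normc z.
Proof. exact: normcN. Qed.

Lemma normcD x y : normc (x + y) <= normc x + normc y.
Proof. exact: le_normcD. Qed.

Lemma normcB x y : normc (x - y) <= normc x + normc y.
Proof. by rewrite -[normc y]normc_sub normcD. Qed.

Lemma normcB_ge x y : normc x - normc y <= normc (x - y).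
Proof. by rewrite lerBlDr (le_trans _ (normcD _ _)) // subrK. Qed.

Lemma normc_eq0 z : (normc z == 0) = (z == 0).
Proof. by apply/eqP/eqP => [/eq0_normc|->] //; rewrite normc0. Qed.

Lemma normc_gt0 z : (0 < normc z) = (z != 0).
Proof. by rewrite lt_neqAle normc_ge0 andbT eq_sym normc_eq0. Qed.

Lemma normcX z n : normc (z ^+ n) = normc z ^+ n.
Proof. by elim: n => [|n IHn]; rewrite ?expr0 ?normc1 // !exprS normcM IHn. Qed.

Lemma normc_real (r : R) : normc r%:C%C = `|r|.
Proof. by rewrite /= expr0n /= addr0 sqrtr_sqr. Qed.

Lemma normc_conj z : normc (conjc z) = normc z.
Proof. by apply: complexI; rewrite -!normr_normc normcJ. Qed.

Lemma mul_conjc z : z * conjc z = ((normc z) ^+ 2)%:C%C.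
Proof. by rewrite -sqr_normc normr_normc rmorphXn. Qed.

Lemma conjc_unit z : normc z = 1 -> conjc z * z = 1.
Proof. by move=> z1; rewrite mulrC mul_conjc z1 expr1n. Qed.

Lemma normc_sum (I : Type) (r : seq I) (P : pred I) (F : I -> C) :
  normc (\sum_(i <- r | P i) F i) <= \sum_(i <- r | P i) normc (F i).
Proof.
elim/big_rec2: _ => [|i y x _ le_xy]; first by rewrite normc0.
by rewrite (le_trans (normcD _ _)) // lerD2l.
Qed.

Lemma normc_prod (I : Type) (r : seq I) (P : pred I) (F : I -> C) :
  normc (\prod_(i <- r | P i) F i) = \prod_(i <- r | P i) normc (F i).
Proof. by elim/big_rec2: _ => [|i y x _ <-]; rewrite ?normc1 ?normcM. Qed.

Lemma normr_eq1 z : (`|z| = 1) <-> (normc z = 1).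
Proof. by rewrite normr_normc; split => [/complexI|->]. Qed.

Lemma normr_le1 z : (`|z| <= 1) = (normc z <= 1).
Proof. by rewrite normr_normc -lecR. Qed.

Lemma in_torus_normc (z : cseq R) : in_torus z -> forall j, normc (z j) = 1.
Proof. by move=> z1 j; apply/normr_eq1. Qed.

Lemma in_torus_polydisc (z : cseq R) : in_torus z -> in_polydisc z.
Proof. by move=> z1 j; rewrite z1. Qed.

Lemma normc_arbitrarily_small z : (forall e : R, 0 < e -> normc z <= e) -> z = 0.
Proof.
move=> small; apply/eqP; rewrite -normc_eq0 eq_le normc_ge0 andbT.
by apply/ler_addgt0Pl => e e0; rewrite addr0 small.
Qed.

Lemma normc_Cartesian (a b : R) : normc (Complex a b) <= `|a| + `|b|.
Proof.
have -> : Complex a b = a%:C%C + Complex 0 1 * b%:C%C.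
  by congr Complex; rewrite ?mul0r ?mul1r /= ?subr0 ?addr0 ?add0r; ring.
rewrite (le_trans (normcD _ _)) // normcM !normc_real.
by rewrite /= expr0n expr1n /= add0r sqrtr1 mul1r.
Qed.

End Modulus.

Section Summation.
Variable R : realType.
Local Notation C := R[i].
Implicit Types K J : choiceType.

(** [has_sum] over an arbitrary index type and with a real-valued modulus: series in powers of one
    coordinate are indexed by [nat], full expansions by [mindex]. *)
Definition hsum K (f : K -> C) (s : C) : Prop :=
  forall e : R, 0 < e -> exists F0 : {fset K},
    forall F : {fset K}, (F0 `<=` F)%fset ->
      normc (s - \sum_(k <- F) f k) < e.

Definition sumbound K (f : K -> C) (M : R) : Prop :=
  forall F : {fset K}, \sum_(k <- F) normc (f k) <= M.

Lemma has_sumP (f : mindex -> C) s : has_sum f s <-> hsum f s.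
Proof.
by split=> sum_s e /sum_s[F0 close]; exists F0 => F /close;
   rewrite normr_normc ltcR.
Qed.

Lemma abs_summableP (a : mindex -> C) :
  abs_summable a <-> exists M, sumbound a M.
Proof.
by split=> -[M bnd]; exists M => F; move: (bnd F);
   rewrite -lecR rmorph_sum.
Qed.

Lemma sum_fset_sub K (V : zmodType) (f : K -> V) (S F : {fset K}) :
  (S `<=` F)%fset ->
  \sum_(k <- F) f k = \sum_(k <- S) f k + \sum_(k <- (F `\` S)%fset) f k.
Proof.
move=> sSF; rewrite (big_fsetID _ (mem S)) /=; congr (_ + _).
  by apply: eq_fbigl => k; rewrite !inE -in_fsetI (fsetIidPr sSF).
by apply: eq_fbigl => k; rewrite !inE andbC.
Qed.

Lemma sumbound_ge0 K (f : K -> C) M : sumbound f M -> 0 <= M.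
Proof. by move/(_ fset0); rewrite big_seq_fset0. Qed.

Lemma bounded_family_sup K (g : K -> R) M :
    (forall k, 0 <= g k) -> (forall F : {fset K}, \sum_(k <- F) g k <= M) ->
  exists l, forall e, 0 < e -> exists S0 : {fset K}, forall F : {fset K},
    (S0 `<=` F)%fset -> l - e < \sum_(k <- F) g k <= l.
Proof.
move=> g_ge0 g_le; pose E := [set x | exists F : {fset K}, x = \sum_(k <- F) g k]%classic.
have supE : has_sup E.
  split; first by exists (\sum_(k <- (fset0 : {fset K})) g k); exists fset0.
  by exists M => _ [F ->].
exists (sup E) => e e_gt0; have [_ [S0 ->] lt_S0] := sup_adherent e_gt0 supE.
exists S0 => F sS0F; apply/andP; split; last first.
  by apply: sup_upper_bound => //; exists F.
apply: lt_le_trans lt_S0 _; rewrite (sum_fset_sub _ sS0F) lerDl.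
by apply: sumr_ge0 => k _.
Qed.

(** The sums of moduli over [S0] and over the union of [S0] and [F] both lie within [e] below the
    supremum, so [F] contributes at most [e]. *)
Lemma sumbound_tail K (f : K -> C) M : sumbound f M ->
  forall e, 0 < e -> exists S0 : {fset K}, forall F : {fset K},
    [disjoint S0 & F]%fset -> \sum_(k <- F) normc (f k) <= e.
Proof.
move=> bnd e e_gt0.
have [l /(_ e e_gt0)[S0 tail]] :=
  bounded_family_sup (fun k => normc_ge0 (f k)) bnd.
exists S0 => F dS0F; have /andP[lt_l _] := tail S0 (fsubset_refl _).
have /andP[_] := tail _ (fsubsetUl S0 F).
rewrite (sum_fset_sub _ (fsubsetUl S0 F)) fsetDUl fsetDv fset0U.
have /fsetDidPl -> : [disjoint F & S0]%fset by rewrite fdisjoint_sym.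
by lra.
Qed.

Lemma tail_sum_le K (f w : K -> C) (e : R) (S0 S F : {fset K}) :
    (forall k, normc (w k) <= 1) ->
    (forall F : {fset K}, [disjoint S0 & F]%fset ->
       \sum_(k <- F) normc (f k) <= e) ->
    (S0 `<=` S)%fset -> (S `<=` F)%fset ->
  normc (\sum_(k <- F) f k * w k - \sum_(k <- S) f k * w k) <= e.
Proof.
move=> w1 tail sS0S sSF; rewrite (sum_fset_sub _ sSF) addrAC subrr add0r.
apply: le_trans (normc_sum _ _ _) _; apply: le_trans (tail (F `\` S)%fset _).
  by apply: ler_sum => k _; rewrite normcM ler_piMr ?normc_ge0.
apply/fdisjointP => k /(fsubsetP sS0S) kS.
by rewrite inE kS.
Qed.

(* Absolute convergence makes the convergence uniform in the bounded weight. *)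
Lemma hsum_uniform K (f : K -> C) M : sumbound f M ->
  forall e, 0 < e -> exists S0 : {fset K}, forall S : {fset K},
    (S0 `<=` S)%fset -> forall (w : K -> C) s, (forall k, normc (w k) <= 1) ->
    hsum (fun k => f k * w k) s -> normc (s - \sum_(k <- S) f k * w k) <= e.
Proof.
move=> bnd e e_gt0; have [S0 tail] := sumbound_tail bnd e_gt0.
exists S0 => S sS0S w s w1 sum_s; apply/ler_addgt0Pr => d d_gt0.
have [F0 close] := sum_s d d_gt0.
have := tail_sum_le w1 tail sS0S (fsubsetUl S F0).
move: (close _ (fsubsetUr S F0)); set x := \sum_(k <- _) _ => lt_d le_e.
rewrite (_ : s - _ = s - x + (x - \sum_(k <- S) f k * w k)); last by ring.
by apply: le_trans (normcD _ _) _; lra.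
Qed.

Lemma summable_hsum K (f : K -> C) M : sumbound f M -> exists s, hsum f s.
Proof.
move=> bnd; have Re_le (z : C) : `|complex.Re z| <= normc z.
  by rewrite -lecR normc_ge_Re.
have Im_le (z : C) : `|complex.Im z| <= normc z.
  have := Re_le (z * Complex 0 1); rewrite ReiNIm normrN normcM.
  by rewrite /= expr0n expr1n /= add0r sqrtr1 mulr1.
have part_sup (g : K -> R) : (forall k, `|g k| <= normc (f k)) ->
    exists l, forall e, 0 < e -> exists S0 : {fset K}, forall F : {fset K},
    (S0 `<=` F)%fset -> `|l - \sum_(k <- F) g k| < e.
  move=> g_le.
  (* A real or imaginary part [g] is the difference of the non-negative families [normc (f k) + g k]
     and [normc (f k)], and monotone convergence applies to both. *)
  have [||l1 sup1] := @bounded_family_sup K (fun k => normc (f k) + g k) (M + M).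
  - by move=> k; move: (g_le k); rewrite ler_norml => /andP[]; lra.
  - move=> F; rewrite big_split /= lerD // (le_trans _ (bnd F)) //.
    by apply: ler_sum => k _; rewrite (le_trans (ler_norm _)).
  have [l0 sup0] := bounded_family_sup (fun k => normc_ge0 (f k)) bnd.
  exists (l1 - l0) => e e_gt0.
  have [S1 close1] := sup1 e e_gt0; have [S0 close0] := sup0 e e_gt0.
  exists (S1 `|` S0)%fset => F sF.
  have /andP[] := close1 F (fsubset_trans (fsubsetUl _ _) sF).
  have /andP[] := close0 F (fsubset_trans (fsubsetUr _ _) sF).
  by rewrite big_split /= ltr_norml => *; apply/andP; split; lra.
have [a sum_a] := part_sup (fun k => complex.Re (f k)) (fun k => Re_le _).
have [b sum_b] := part_sup (fun k => complex.Im (f k)) (fun k => Im_le _).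
exists (Complex a b) => e e_gt0; have e2 : 0 < e / 2 by lra.
have [S1 close1] := sum_a _ e2; have [S2 close2] := sum_b _ e2.
exists (S1 `|` S2)%fset => F sF.
have := close1 F (fsubset_trans (fsubsetUl _ _) sF).
have := close2 F (fsubset_trans (fsubsetUr _ _) sF) => lt2 lt1.
have -> : \sum_(k <- F) f k =
    Complex (\sum_(k <- F) complex.Re (f k)) (\sum_(k <- F) complex.Im (f k)).
  elim: (F : seq K) => [|k r IHr]; first by rewrite !big_nil.
  by rewrite !big_cons IHr; case: (f k).
by apply: le_lt_trans (normc_Cartesian _ _) _; lra.
Qed.

Lemma hsum_unique K (f : K -> C) s t : hsum f s -> hsum f t -> s = t.
Proof.
move=> sum_s sum_t; apply/eqP; rewrite -subr_eq0; apply/eqP.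
apply: normc_arbitrarily_small => e e_gt0; have e2 : 0 < e / 2 by lra.
have [S close_s] := sum_s _ e2; have [T close_t] := sum_t _ e2.
have := close_s _ (fsubsetUl S T); have := close_t _ (fsubsetUr S T).
set x := \sum_(k <- _) _ => lt_t lt_s.
rewrite (_ : s - t = s - x - (t - x)); last by ring.
by apply: le_trans (normcB _ _) _; lra.
Qed.

Lemma hsum_finite K (f : K -> C) (S : {fset K}) :
  (forall k, k \notin S -> f k = 0) -> hsum f (\sum_(k <- S) f k).
Proof.
move=> f0 e e_gt0; exists S => F sSF.
rewrite (big_fset_incl _ sSF) ?subrr ?normc0 // => k _; exact: f0.
Qed.

(** * Moving a family along an injection of index sets *)

Section Pushforward.
Variables (K J : choiceType) (e : K -> J) (f : K -> C) (G : J -> C).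
Hypothesis e_inj : injective e.
Hypothesis Ge : forall k, G (e k) = f k.
Hypothesis G0 : forall j, (forall k, j <> e k) -> G j = 0.

(** Off the range of [e] the terms vanish, so only the preimage [F'] of [F] counts. Taking [t] to be
    the modulus transports absolute bounds; taking it to be the identity transports sums. *)
Lemma sum_pushforward (V : zmodType) (t : C -> V) (F : {fset J}) :
  t 0 = 0 ->
  exists2 F' : {fset K}, \sum_(j <- F) t (G j) = \sum_(k <- F') t (f k) &
    forall k, e k \in F -> k \in F'.
Proof.
move=> t0; have [inv invP] : exists inv : J -> option K,
    forall j, if inv j is Some k then j = e k else forall k, j <> e k.
  have : forall j, exists o : option K,
      if o is Some k then j = e k else forall k, j <> e k.
    move=> j; have [[k ->]|nex] := pselect (exists k, j = e k).
      by exists (Some k).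
    by exists None => k jk; apply: nex; exists k.
  by case/choice => inv; exists inv.
have inv_e k : inv (e k) = Some k.
  by move: (invP (e k)); case: (inv (e k)) => [k' /e_inj ->|/(_ k)].
pose F' := [fset k | k in pmap inv F]%fset; exists F'.
  have -> : \sum_(k <- F') t (f k) = \sum_(j <- [fset e k | k in F']%fset) t (G j).
    rewrite [RHS]big_imfset /=; last by move=> x y _ _ /e_inj.
    by apply: eq_bigr => k _; rewrite Ge.
  apply/esym/big_fset_incl.
    apply/fsubsetP => j /imfsetP[k /= kF' ->]; move: kF'.
    rewrite inE /= mem_pmap => /mapP[i iF].
    by move: (invP i) iF; case: (inv i) => // k' -> iF [->].
  move=> j jF jN; rewrite G0 // => k jk; move: jN; rewrite jk in_imfset //=.
  by rewrite inE /= mem_pmap -inv_e map_f // -jk.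
by move=> k ekF; rewrite inE /= mem_pmap -inv_e map_f.
Qed.

Lemma sumbound_pushforward M : sumbound f M -> sumbound G M.
Proof.
move=> bnd F; have [|F' -> _] := @sum_pushforward _ (@normc R) F.
  exact: normc0.
exact: bnd.
Qed.

Lemma hsum_pushforward s : hsum f s -> hsum G s.
Proof.
move=> sum_s d /sum_s[F0 close]; exists [fset e k | k in F0]%fset => F sF.
have [//|F' -> eF'] := @sum_pushforward _ idfun F.
apply: close; apply/fsubsetP => k kF0; apply: eF'.
by apply: (fsubsetP sF); rewrite in_imfset.
Qed.

End Pushforward.

End Summation.

(** * Uniform limits of polynomials on the circle *)

Section CircleFunctions.
Variable R : realType.
Local Notation C := R[i].
Implicit Types (p q : {poly C}) (h F G : C -> C).

(** ['X^n - 1] splits and is separable, so it has [n] distinct roots, and among [n] distinct [n]-th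
    roots of unity one is primitive. *)
Lemma prim_root_exists n : (0 < n)%N -> exists w : C, n.-primitive_root w.
Proof.
move=> n_gt0; pose p : {poly C} := 'X^n - 1.
have [r Dp] := closed_field_poly_normal p.
rewrite (monicP _) ?monicXnsubC // scale1r in Dp.
have rn1 : all n.-unity_root r by apply/allP=> z; rewrite -root_prod_XsubC -Dp.
have sz_r : (n < (size r).+1)%N.
  by rewrite -(size_prod_XsubC r id) -Dp size_XnsubC.
have [|z] := hasP (has_prim_root n_gt0 rn1 _ sz_r); last by exists z.
rewrite -separable_prod_XsubC -Dp separable_Xn_sub_1 //.
by rewrite pnatr_eq0 -lt0n.
Qed.

Lemma normc_prim_root n (w : C) : n.-primitive_root w -> normc w = 1.
Proof.
move=> pw; have n_gt0 := prim_order_gt0 pw.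
have /eqP := congr1 (@normc R) (prim_expr_order pw).
rewrite normcX normc1 => /eqP w1.
by apply/eqP; rewrite -(@pexpr_eq1 _ _ n) ?normc_ge0 // -?lt0n // w1.
Qed.

Lemma sum_prim_root_powers n (w : C) m : n.-primitive_root w ->
  \sum_(i < n) (w ^+ m) ^+ i = if (n %| m)%N then n%:R else 0.
Proof.
move=> pw; case: ifP => [n_m|/negbT n_m].
  have -> : w ^+ m = 1 by apply/eqP; rewrite -(prim_order_dvd pw).
  by under eq_bigr do rewrite expr1n; rewrite sumr_const card_ord.
apply: (@mulfI _ (w ^+ m - 1)).
  by rewrite subr_eq0 -(prim_order_dvd pw).
by rewrite -subrX1 mulr0 exprAC (prim_expr_order pw) expr1n subrr.
Qed.

Definition circle_close h p (e : R) : Prop :=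
  forall z : C, normc z = 1 -> normc (h z - p.[z]) <= e.

(* The coefficient is a mean of values of [p] over roots of unity. *)
Lemma cauchy_estimate p (e : R) k :
  (forall z : C, normc z = 1 -> normc p.[z] <= e) -> normc p`_k <= e.
Proof.
(* [n] exceeds both the degree of [p] and [k], so among the [j < n] only [j = k] makes [n] divide
   [j + (n - k)]; the power [n - k] plays the part of [- k]. *)
move=> p_le; pose n := (size p + k).+1.
have [w pw] := prim_root_exists (ltn0Sn (size p + k)); rewrite -/n in pw.
have w1 := normc_prim_root pw.
have : \sum_(i < n) p.[w ^+ i] * (w ^+ i) ^+ (n - k) = n%:R * p`_k.
  under eq_bigr => i _.
    rewrite (@horner_coef_wide _ n); last by rewrite /n; lia.
    rewrite mulr_suml; under eq_bigr => j _.
      rewrite -mulrA -exprD -exprM mulnC exprM; over.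
    over.
  rewrite exchange_big /=; under eq_bigr => j _.
    rewrite -mulr_sumr (sum_prim_root_powers _ pw); over.
  have kn : (k < n)%N by rewrite /n; lia.
  rewrite (bigD1 (Ordinal kn)) //= subnKC ?(ltnW kn) // dvdnn mulrC.
  rewrite big1 ?addr0 // => j jk; case: ifP => [/dvdnP[c]|]; last by rewrite mulr0.
  have : (j : nat) != k by apply: contraNneq jk => jk; apply/eqP/val_inj.
  have := ltn_ord j; move: (nat_of_ord j) => i lt_i ik eq_c; exfalso.
  have : (i + (n - k) = c * n)%N by [].
  by case: c {eq_c} => [|[|c]]; rewrite ?mulSn; nia.
move/(congr1 (@normc R)); rewrite normcM => eq_n.
have n0 : 0 < n%:R :> R by rewrite ltr0n.
have normc_n : normc (n%:R : C) = n%:R.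
  by rewrite -(rmorph_nat (real_complex R)) normc_real ger0_norm ?ltW.
rewrite -(ler_pM2l n0) -[X in X * normc _]normc_n -eq_n.
apply: le_trans (normc_sum _ _ _) _.
rewrite mulr_natl -[X in _ *+ X](card_ord n) -sumr_const; apply: ler_sum => i _.
by rewrite normcM !normcX w1 !expr1n mulr1 p_le // normcX w1 expr1n.
Qed.

(** The difference of two approximants is small on the circle, so [cauchy_estimate] applies to it.
    This stands in for the Fourier coefficients of [h], which are never defined. *)
Lemma circle_close_coef h p q (d e : R) k :
  circle_close h p d -> circle_close h q e -> normc (p`_k - q`_k) <= d + e.
Proof.
move=> hp hq; rewrite -coefB; apply: cauchy_estimate => z z1.
rewrite hornerD hornerN (_ : _ - _ = h z - q.[z] - (h z - p.[z])); last by ring.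
by apply: le_trans (normcB _ _) _; rewrite addrC lerD ?hp ?hq.
Qed.

(** * Lowest Fourier coefficients of uniform limits of polynomials *)

Definition disc_algebra h : Prop :=
  forall e : R, 0 < e -> exists p, circle_close h p e.

(** In substance, the lowest non-zero Fourier coefficient of [F] sits at [s]. Approximants that
    vanish exactly below [s] make the property stable under products. *)
Definition leading_coef_bounded_below F : Prop :=
  exists s (d : R), 0 < d /\ forall e : R, 0 < e -> exists p,
    [/\ circle_close F p e, forall k, (k < s)%N -> p`_k = 0 & d <= normc p`_s].

Lemma poly_circle_bound p :
  exists2 B : R, 0 <= B & forall z, normc z = 1 -> normc p.[z] <= B.
Proof.
exists (\sum_(i < size p) normc p`_i) => [|z z1].
  by apply: sumr_ge0 => i _; apply: normc_ge0.
rewrite horner_coef; apply: le_trans (normc_sum _ _ _) _.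
by apply: ler_sum => i _; rewrite normcM normcX z1 expr1n mulr1.
Qed.

Lemma circle_close_bound h p (e : R) : circle_close h p e ->
  exists2 B : R, 0 <= B & forall z, normc z = 1 -> normc (h z) <= B.
Proof.
move=> hp; have [B B0 pB] := poly_circle_bound p.
exists (B + e) => [|z z1].
  by rewrite addr_ge0 // (le_trans (normc_ge0 _) (hp 1 _)) ?normc1.
rewrite -[h z](subrK p.[z]) addrC; apply: le_trans (normcD _ _) _.
by rewrite lerD ?pB ?hp.
Qed.

Lemma normc_mulB_le (a b x y : C) (B e : R) :
    normc a <= B -> normc b <= B -> normc (a - x) <= e -> normc (b - y) <= e ->
    e <= 1 -> normc (a * b - x * y) <= e * (B + B + 1).
Proof.
move=> aB bB ax byy e1; have e0 := le_trans (normc_ge0 _) ax.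
have B0 := le_trans (normc_ge0 _) aB.
have xB : normc x <= B + 1.
  have := normcB a (a - x); rewrite (_ : a - (a - x) = x); last by ring.
  by move=> le_x; lra.
rewrite (_ : _ - _ = (a - x) * b + x * (b - y)); last by ring.
apply: le_trans (normcD _ _) _; rewrite !normcM.
have := ler_pM (normc_ge0 _) (normc_ge0 _) ax bB.
have := ler_pM (normc_ge0 _) (normc_ge0 _) xB byy.
by nra.
Qed.

Lemma leading_coef_bounded_below1 : leading_coef_bounded_below (fun=> 1).
Proof.
exists 0%N, 1; split=> // e e_gt0; exists 1; split=> //.
  by move=> z _; rewrite hornerC subrr normc0 ltW.
by rewrite coef1 normc1.
Qed.

(** Lowest terms multiply: below [s + t] every term of the Cauchy product has a vanishing factor,
    and at [s + t] only the product of the two lowest coefficients survives. *)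
Lemma leading_coef_bounded_belowM F G :
  leading_coef_bounded_below F -> leading_coef_bounded_below G ->
  leading_coef_bounded_below (fun z => F z * G z).
Proof.
move=> [s [a [a_gt0 Fs]]] [t [b [b_gt0 Gt]]]; exists (s + t)%N, (a * b).
split=> [|e e_gt0]; first exact: mulr_gt0.
have [p0 [Fp0 _ _]] := Fs 1 ltr01; have [q0 [Gq0 _ _]] := Gt 1 ltr01.
have [B1 B10 FB] := circle_close_bound Fp0; have [B2 B20 GB] := circle_close_bound Gq0.
(* [B] bounds both functions on the circle, and [d] is small enough for [normc_mulB_le] to give an
   error of at most [e]. *)
pose B := B1 + B2; pose d := Num.min 1 (e / (B + B + 1)).
have den : 0 < B + B + 1 by rewrite /B; lra.
have d_gt0 : 0 < d by rewrite lt_min ltr01 divr_gt0.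
have [p [Fp p0s ps]] := Fs d d_gt0; have [q [Gq q0t qt]] := Gt d d_gt0.
exists (p * q); split.
- move=> z z1; rewrite hornerM.
  apply: le_trans (@normc_mulB_le _ _ _ _ B d _ _ (Fp z z1) (Gq z z1) _) _.
  + by rewrite /B; have := FB z z1; lra.
  + by rewrite /B; have := GB z z1; lra.
  + by rewrite ge_min lexx.
  by rewrite -ler_pdivlMr // ge_min lexx orbT.
- move=> k lt_k; rewrite coefM big1 // => i _.
  have [/p0s->|le_si] := ltnP i s; first by rewrite mul0r.
  by rewrite q0t ?mulr0 //; move: (ltn_ord i) lt_k le_si; clear; lia.
have st : (s < (s + t).+1)%N by rewrite ltnS leq_addr.
rewrite coefM (bigD1 (Ordinal st)) //= addKn big1 ?addr0.
  by rewrite normcM ler_pM // ltW.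
move=> i ne_i; have [/p0s->|le_si] := ltnP i s; first by rewrite mul0r.
rewrite q0t ?mulr0 //; have : (i : nat) != s.
  by apply: contraNneq ne_i => /= is_; apply/eqP/val_inj.
by move: (ltn_ord i) le_si; clear; lia.
Qed.

Lemma leading_coef_bounded_below_prod (I : Type) (r : seq I) (P : pred I)
    (F : I -> C -> C) :
  (forall i, P i -> leading_coef_bounded_below (F i)) ->
  leading_coef_bounded_below (fun z => \prod_(i <- r | P i) F i z).
Proof.
move=> Fi; elim: r => [|i r IHr].
  rewrite (_ : (fun z => _) = fun=> 1); first exact: leading_coef_bounded_below1.
  by apply/funext => z; rewrite big_nil.
case Pi: (P i); last first.
  rewrite (_ : (fun z => _) = fun z => \prod_(i <- r | P i) F i z) //.
  by apply/funext => z; rewrite big_cons Pi.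
rewrite (_ : (fun z => _) = fun z => F i z * \prod_(i <- r | P i) F i z).
  by apply: leading_coef_bounded_belowM => //; apply: Fi.
by apply/funext => z; rewrite big_cons Pi.
Qed.

(** If [F] vanished on the circle, an approximant within [d / 2] would be at most [d / 2] there, and
    so would its coefficient at [s], by [cauchy_estimate]. *)
Lemma leading_coef_bounded_below_neq0 F :
  leading_coef_bounded_below F -> exists2 z, normc z = 1 & F z != 0.
Proof.
move=> [s [d [d_gt0 Fs]]]; have d2 : 0 < d / 2 by lra.
have [p [Fp _ le_d]] := Fs _ d2; apply: contrapT => nex.
suff : normc p`_s <= d / 2 by lra.
apply: cauchy_estimate => z z1; have [Fz0|Fz] := eqVneq (F z) 0.
  by have := Fp z z1; rewrite Fz0 sub0r normc_sub.
by case: nex; exists z.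
Qed.

Lemma two_leading_coefs h p0 (e0 : R) k1 k2 :
    disc_algebra h -> circle_close h p0 e0 -> k1 != k2 ->
    e0 < normc p0`_k1 -> e0 < normc p0`_k2 ->
  exists s r (d : R), [/\ (s < r)%N, 0 < d & forall e, 0 < e -> exists p,
    [/\ circle_close h p e, forall k, (k < r)%N -> k != s -> p`_k = 0,
        d <= normc p`_s & d <= normc p`_r]].
Proof.
move=> hD hp0 k12 pk1 pk2.
wlog lt12 : k1 k2 k12 pk1 pk2 / (k1 < k2)%N => [th|].
  have [lt12|lt21|eq12] := ltngtP k1 k2; first exact: (th k1 k2).
  - by apply: (th k2 k1) => //; rewrite eq_sym.
  - by rewrite eq12 eqxx in k12.
(* An approximant whose coefficient exceeds its error certifies a non-zero Fourier coefficient; [s]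
   and [r] are the two smallest such indices. *)
pose nonnull k := `[< exists p e, circle_close h p e /\ e < normc p`_k >].
have nn1 : nonnull k1 by apply/asboolP; exists p0, e0.
have nn2 : nonnull k2 by apply/asboolP; exists p0, e0.
have nonnull_le k : nonnull k -> exists2 d : R, 0 < d &
    forall p e, circle_close h p e -> d - e <= normc p`_k.
  move=> /asboolP[p1 [e1 [hp1 lt1]]]; exists (normc p1`_k - e1); first by lra.
  move=> p e hp; have := circle_close_coef k hp1 hp.
  by have := normcB_ge p1`_k p`_k; lra.
have [s nns s_min] := ex_minnP (ex_intro nonnull k1 nn1).
have [|r /andP[sr nnr] r_min] := @ex_minnP (fun k => (s < k)%N && nonnull k).
  by exists k2; rewrite nn2 (leq_ltn_trans (s_min _ nn1) lt12).
have null k p e : (k < r)%N -> k != s -> circle_close h p e -> normc p`_k <= e.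
  move=> kr ks hp; rewrite leNgt; apply/negP => lt_e.
  have nnk : nonnull k by apply/asboolP; exists p, e.
  have := s_min _ nnk; rewrite leq_eqVlt eq_sym (negPf ks) /= => sk.
  by have := r_min k; rewrite sk nnk leqNgt kr => /(_ isT).
have [ds ds0 le_ds] := nonnull_le s nns; have [dr dr0 le_dr] := nonnull_le r nnr.
(* Half of the smaller bound, so that an error of at most [d] still leaves [d] in both
   coefficients. *)
pose d := Num.min ds dr / 2; exists s, r, d; have d_gt0 : 0 < d.
  by rewrite /d divr_gt0 // lt_min ds0.
have d2s : d + d <= ds by rewrite /d -splitr ge_min lexx.
have d2r : d + d <= dr by rewrite /d -splitr ge_min lexx orbT.
split=> // e e_gt0; pose n := Num.min d (e / r.+1%:R).
have n_gt0 : 0 < n by rewrite lt_min d_gt0 divr_gt0 ?ltr0n.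
have n_d : n <= d by rewrite ge_min lexx.
have n_e : n * r.+1%:R <= e by rewrite -ler_pdivlMr ?ltr0n // ge_min lexx orbT.
have [p hp] := hD n n_gt0.
(* Each removed coefficient is at most [n], so subtracting [low] costs at most [n * r] on top of the
   error [n]; hence the choice of [n]. *)
pose low := \poly_(k < r) (if k == s then 0 else p`_k).
exists (p - low); split.
- move=> z z1; rewrite hornerD hornerN.
  rewrite (_ : _ - _ = h z - p.[z] + low.[z]); last by ring.
  apply: le_trans (normcD _ _) (le_trans _ n_e).
  rewrite mulrS mulrDr mulr1 lerD ?hp //.
  rewrite horner_poly; apply: le_trans (normc_sum _ _ _) _.
  rewrite mulr_natr -[X in _ *+ X](card_ord r) -sumr_const; apply: ler_sum => k _.
  rewrite normcM normcX z1 expr1n mulr1; case: eqP => [_|/eqP ks].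
    by rewrite normc0 ltW.
  exact: null hp.
- by move=> k kr ks; rewrite coefB coef_poly kr (negPf ks) subrr.
- by rewrite coefB coef_poly sr eqxx subr0; have := le_ds _ _ hp; lra.
- by rewrite coefB coef_poly ltnn subr0; have := le_dr _ _ hp; lra.
Qed.

(* The common term [X^(s (m1 + m4))] cancels, so the lowest coefficient is the
   one at [r m1 + s m4], which only the first product reaches. *)
Lemma coef_cross_difference p s r m1 m2 m3 m4 k :
    (s < r)%N -> (0 < m1)%N -> (m1 < m2)%N -> (m1 < m3)%N ->
    (m1 + m4 = m2 + m3)%N ->
    (forall k, (k < r)%N -> k != s -> p`_k = 0) -> (k <= r * m1 + s * m4)%N ->
  ((p \Po 'X^m1) * (p \Po 'X^m4) - (p \Po 'X^m2) * (p \Po 'X^m3))`_k =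
  if k == (r * m1 + s * m4)%N then p`_s * p`_r else 0.
Proof.
move=> sr m1_gt0 m12 m13 m14 p0 le_k; set e := (_ + _)%N in le_k *.
pose q := drop_poly r p.
have Dp : p = p`_s *: 'X^s + q * 'X^r.
  rewrite -{1}(poly_take_drop r p); congr (_ + _); apply/polyP => i.
  rewrite coef_take_poly coefZ coefXn; case: eqP => [->|/eqP is_].
    by rewrite sr mulr1.
  by case: ifP => [ir|_]; rewrite mulr0 // p0.
pose Q m := q \Po 'X^m; pose a := p`_s.
have DpX m : p \Po 'X^m = a%:P * 'X^(s * m) + Q m * 'X^(r * m).
  rewrite {1}Dp comp_polyD comp_polyZ comp_polyM !rmorphXn /= comp_polyX.
  by rewrite -mul_polyC -!exprM ![(m * _)%N]mulnC.
have mon x y : 'X^x * 'X^y = 'X^(x + y) :> {poly C} by rewrite exprD.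
have -> : (p \Po 'X^m1) * (p \Po 'X^m4) - (p \Po 'X^m2) * (p \Po 'X^m3) =
    Q m1 * a%:P * 'X^e + (a%:P * Q m4 * 'X^(s * m1 + r * m4)
    + Q m1 * Q m4 * 'X^(r * m1 + r * m4)
    - (Q m2 * a%:P * 'X^(r * m2 + s * m3) + a%:P * Q m3 * 'X^(s * m2 + r * m3)
       + Q m2 * Q m3 * 'X^(r * m2 + r * m3))).
  have : 'X^(s * m1) * 'X^(s * m4) = 'X^(s * m2) * 'X^(s * m3) :> {poly C}.
    by rewrite !mon -!mulnDr m14.
  rewrite !DpX /e -!mon.
  move: ('X^(s * m1)) ('X^(s * m2)) ('X^(s * m3)) ('X^(s * m4)) => A1 A2 A3 A4.
  move: ('X^(r * m1)) ('X^(r * m2)) ('X^(r * m3)) ('X^(r * m4)) => B1 B2 B3 B4.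
  move=> AA; have -> : forall c x1 x2 x3 x4 : {poly C},
    (c * A1 + x1 * B1) * (c * A4 + x4 * B4) -
    (c * A2 + x2 * B2) * (c * A3 + x3 * B3) = c ^+ 2 * (A1 * A4 - A2 * A3) +
    (x1 * c * (B1 * A4) + (c * x4 * (A1 * B4) + x1 * x4 * (B1 * B4)
    - (x2 * c * (B2 * A3) + c * x3 * (A2 * B3) + x2 * x3 * (B2 * B3)))).
    by move=> *; ring.
  by rewrite AA subrr mulr0 add0r.
have high (A : {poly C}) x : (e < x)%N -> (A * 'X^x)`_k = 0.
  by move=> lt_x; rewrite coefMXn (leq_ltn_trans le_k lt_x).
(* The remaining exponents exceed [e] by [r - s] times [m4 - m1], [m4], [m2 - m1] or [m3 - m1];
   these substitutions remove the subtractions. *)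
have [t Dt] : exists t, r = (s + t.+1)%N by exists (r - s.+1)%N; lia.
have [u Du] : exists u, m2 = (m1 + u.+1)%N by exists (m2 - m1.+1)%N; lia.
have [v Dv] : exists v, m3 = (m1 + v.+1)%N by exists (m3 - m1.+1)%N; lia.
have Dw : m4 = (m1 + u.+1 + v.+1)%N by lia.
rewrite coefD coefMXn !(coefD, coefN) !high; try by rewrite /e Dt Dw ?Du ?Dv; nia.
rewrite !addr0 subr0 addr0 ltn_neqAle le_k andbT.
(* As [m1 > 0], the constant term of [Q m1] is that of [q], namely the coefficient of [p] at [r]. *)
case: eqP => [->|_] //=; rewrite subnn coefMC -horner_coef0 /Q horner_comp.
rewrite hornerXn expr0n eqn0Ngt m1_gt0 /= horner_coef0 mulrC.
by rewrite /q coef_drop_poly add0n.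
Qed.

Lemma cross_difference_leading h s r (d : R) m1 m2 m3 m4 :
    (s < r)%N -> 0 < d -> (0 < m1)%N -> (m1 < m2)%N -> (m1 < m3)%N ->
    (m1 + m4 = m2 + m3)%N ->
    (forall e, 0 < e -> exists p,
      [/\ circle_close h p e, forall k, (k < r)%N -> k != s -> p`_k = 0,
          d <= normc p`_s & d <= normc p`_r]) ->
  leading_coef_bounded_below
    (fun z => h (z ^+ m1) * h (z ^+ m4) - h (z ^+ m2) * h (z ^+ m3)).
Proof.
move=> sr d_gt0 m1_gt0 m12 m13 m14 happ.
exists (r * m1 + s * m4)%N, (d * d); split=> [|e e_gt0]; first exact: mulr_gt0.
have [p1 [hp1 _ _ _]] := happ 1 ltr01.
have [B B0 hB] := circle_close_bound hp1.
have den : 0 < (B + B + 1) * 2 by lra.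
pose n := Num.min 1 (e / ((B + B + 1) * 2)).
have n_gt0 : 0 < n by rewrite lt_min ltr01 divr_gt0.
have n1 : n <= 1 by rewrite ge_min lexx.
have n_e : n * ((B + B + 1) * 2) <= e.
  by rewrite -ler_pdivlMr // ge_min lexx orbT.
have [p [hp p0 ps pr]] := happ n n_gt0.
exists ((p \Po 'X^m1) * (p \Po 'X^m4) - (p \Po 'X^m2) * (p \Po 'X^m3)); split.
- move=> z z1; have zX m : normc (z ^+ m) = 1 by rewrite normcX z1 expr1n.
  rewrite hornerD hornerN !hornerM !horner_comp !hornerXn.
  pose D x y := h (z ^+ x) * h (z ^+ y) - p.[z ^+ x] * p.[z ^+ y].
  have Dle x y : normc (D x y) <= n * (B + B + 1).
    by apply: normc_mulB_le => //; rewrite ?hB ?hp.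
  rewrite (_ : _ - _ = D m1 m4 - D m2 m3); last by rewrite /D; ring.
  apply: le_trans (normcB _ _) _; have := Dle m1 m4; have := Dle m2 m3; lra.
- move=> k lt_k.
  have := coef_cross_difference sr m1_gt0 m12 m13 m14 p0 (ltnW lt_k).
  by rewrite ltn_eqF.
have := coef_cross_difference sr m1_gt0 m12 m13 m14 p0 (leqnn _).
by rewrite eqxx => ->; rewrite normcM ler_pM // ltW.
Qed.

End CircleFunctions.

(** * Entrywise powers of a unimodular Hankel matrix *)

Section HankelTest.
Variable R : realType.
Local Notation C := R[i].

(** Cauchy-Schwarz against the constant family 1: the defect is half the sum of all
    [(x i - x k) ^+ 2]. *)
Lemma sum_sqr_le (I : finType) (x : I -> R) :
  (\sum_i x i) ^+ 2 <= #|I|%:R * \sum_i x i ^+ 2.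
Proof.
have : 0 <= \sum_i \sum_k (x i - x k) ^+ 2.
  by apply: sumr_ge0 => i _; apply: sumr_ge0 => k _; apply: sqr_ge0.
rewrite (_ : \sum_i _ = 2 * (#|I|%:R * (\sum_i x i ^+ 2) - (\sum_i x i) ^+ 2)).
  by lra.
transitivity (\sum_i (#|I|%:R * x i ^+ 2 + \sum_k x k ^+ 2 - 2 * (\sum_k x k) * x i)).
  apply: eq_bigr => i _.
  transitivity (\sum_k (x i ^+ 2 + (x k ^+ 2 - 2 * x i * x k))).
    by apply: eq_bigr => k _; ring.
  by rewrite !big_split /= sumr_const -mulr_natl sumrN -mulr_sumr; ring.
by rewrite sumrB big_split /= sumr_const -!mulr_sumr -mulr_natl; ring.
Qed.

(* [gram4 V] is the trace of [(V^* V)^2], which dominates the fourth power of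
   the operator norm of [V]. *)
Definition gram4 L (V : 'I_L -> 'I_L -> C) : R :=
  \sum_l \sum_l' normc (\sum_j V j l * conjc (V j l')) ^+ 2.

(** Cauchy-Schwarz twice: first over [j], which leads to the sum of the [normc (Y j) ^+ 2], at most
    the sum of the moduli of the Gram entries [G l l']; then over the pairs [(l, l')]. *)
Lemma bilinear_gram4 L (V : 'I_L -> 'I_L -> C) (a b : 'I_L -> C) :
    (forall j, normc (a j) = 1) -> (forall l, normc (b l) = 1) ->
  normc (\sum_j \sum_l V j l * (a j * b l)) ^+ 4 <= L%:R ^+ 4 * gram4 V.
Proof.
move=> a1 b1; pose Y j := \sum_l V j l * b l.
pose G l l' := \sum_j V j l * conjc (V j l').
have le_T : normc (\sum_j \sum_l V j l * (a j * b l)) <= \sum_j normc (Y j).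
  apply: le_trans (normc_sum _ _ _) _; apply: ler_sum => j _.
  rewrite (_ : \sum_l _ = a j * Y j) ?normcM ?a1 ?mul1r //.
  by rewrite /Y mulr_sumr; apply: eq_bigr => l _; ring.
have sum_Y : \sum_j normc (Y j) ^+ 2 <= \sum_l \sum_l' normc (G l l').
  have : (\sum_j normc (Y j) ^+ 2)%:C%C =
      \sum_l \sum_l' b l * conjc (b l') * G l l'.
    rewrite rmorph_sum /=; under eq_bigr => j _.
      rewrite -mul_conjc /Y mulr_suml; under eq_bigr => l _.
        rewrite rmorph_sum /= mulr_sumr; over.
      over.
    rewrite exchange_big /=; apply: eq_bigr => l _.
    rewrite exchange_big /=; apply: eq_bigr => l' _.
    by rewrite mulr_sumr; apply: eq_bigr => j _; rewrite rmorphM /=; ring.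
  move=> eq_Y; have Y0 : 0 <= \sum_j normc (Y j) ^+ 2.
    by apply: sumr_ge0 => j _; apply: sqr_ge0.
  rewrite -(ger0_norm Y0) -normc_real eq_Y.
  apply: le_trans (normc_sum _ _ _) _; apply: ler_sum => l _.
  apply: le_trans (normc_sum _ _ _) _; apply: ler_sum => l' _.
  by rewrite !normcM normc_conj !b1 !mul1r.
have sum_G : (\sum_l \sum_l' normc (G l l')) ^+ 2 <= L%:R ^+ 2 * gram4 V.
  rewrite pair_big /= /gram4 (pair_big xpredT xpredT) /=.
  apply: le_trans (sum_sqr_le _) _.
  by rewrite card_prod card_ord natrM expr2.
have sqr_T := @sum_sqr_le _ (fun j => normc (Y j)); rewrite card_ord in sqr_T.
have T0 := normc_ge0 (\sum_j \sum_l V j l * (a j * b l)).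
move: le_T sum_Y sum_G sqr_T T0.
move: (normc (\sum_j _)) (\sum_j normc (Y j)) (\sum_j normc (Y j) ^+ 2) => t y y2.
move: (\sum_l _) (gram4 V) => s g ty ys sg yy t0.
have L0 : 0 <= L%:R :> R by rewrite ler0n.
have t2 : t ^+ 2 <= L%:R * s.
  apply: le_trans (_ : y ^+ 2 <= _).
    by rewrite ler_sqr ?nnegrE // (le_trans t0).
  by rewrite (le_trans yy) // ler_wpM2l.
rewrite (_ : t ^+ 4 = t ^+ 2 ^+ 2); last by ring.
rewrite (_ : L%:R ^+ 4 * g = L%:R ^+ 2 * (L%:R ^+ 2 * g)); last by ring.
apply: le_trans (_ : (L%:R * s) ^+ 2 <= _).
  by rewrite ler_sqr ?nnegrE ?sqr_ge0 // (le_trans _ t2) ?sqr_ge0.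
by rewrite exprMn ler_wpM2l ?sqr_ge0.
Qed.

Lemma geometric_sum_bound (z : C) a N : normc z = 1 -> z != 1 ->
  normc (\sum_(i < N) z ^+ (a + i)) <= 2 / normc (z - 1).
Proof.
move=> z1 ne1; have d_gt0 : 0 < normc (z - 1) by rewrite normc_gt0 subr_eq0.
under eq_bigr do rewrite exprD; rewrite -mulr_sumr normcM normcX z1 expr1n mul1r.
rewrite ler_pdivlMr // mulrC -normcM -subrX1.
by apply: le_trans (normcB _ _) _; rewrite normcX z1 expr1n normc1.
Qed.

(* In the mean over [n], only the terms of [gram4] with [j = j'] or [l = l']
   survive, and there are fewer than [2 L^3] of them. *)
Lemma gram4_powers_small L (u : 'I_L -> 'I_L -> C) N0 : (0 < L)%N ->
    (forall j l, normc (u j l) = 1) ->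
    (forall j j' l l', j != j' -> l != l' ->
       u j l * u j' l' != u j' l * u j l') ->
  exists2 n, (N0 < n)%N & gram4 (fun j l => u j l ^+ n) <= 3 * L%:R ^+ 3.
Proof.
move=> L_gt0 u1 u_indep.
(* The powers [zeta ^+ n] are the terms of the expanded [gram4]; by [u_indep], [zeta] can be 1 only
   if [l = l'] or [j = j']. *)
pose zeta l l' j j' := u j l * conjc (u j l') * conjc (u j' l * conjc (u j' l')).
have zeta1 l l' j j' : normc (zeta l l' j j') = 1.
  by rewrite !(normcM, normc_conj, u1) !mulr1.
have gram4E n : (gram4 (fun j l => u j l ^+ n))%:C%C =
    \sum_l \sum_l' \sum_j \sum_j' zeta l l' j j' ^+ n.
  rewrite /gram4 rmorph_sum; apply: eq_bigr => l _.
  rewrite rmorph_sum; apply: eq_bigr => l' _ /=.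
  rewrite -mul_conjc mulr_suml; apply: eq_bigr => j _.
  rewrite rmorph_sum /= mulr_sumr; apply: eq_bigr => j' _.
  by rewrite /zeta !(rmorphM, exprMn, rmorphXn) /=.
(* Bounds for the geometric sums of [zeta], independent of their length. Where [zeta] is 1 the
   quotient is 0 by convention, and the sum is bounded by its number [N] of terms instead. *)
pose D l l' j j' : R := 2 / normc (zeta l l' j j' - 1).
have D0 l l' j j' : 0 <= D l l' j j' by rewrite divr_ge0 ?normc_ge0.
pose Dsum := \sum_l \sum_l' \sum_j \sum_j' D l l' j j'.
apply: contrapT => nex.
have gram4_large n : (N0 < n)%N -> 3 * L%:R ^+ 3 < gram4 (fun j l => u j l ^+ n).
  by move=> lt_n; rewrite ltNge; apply/negP => le_n; apply: nex; exists n.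
(* If all exponents beyond [N0] failed, the sum of [gram4] over [N] of them would be at least
   [3 * N * L ^ 3], whereas the terms with [l = l'] or [j = j'] account for [2 * N * L ^ 3] and the
   others for [Dsum]: absurd for large [N]. *)
suff bnd N : N%:R * L%:R ^+ 3 <= Dsum.
  have [N lt_N] : exists N, Dsum < N%:R.
    exists (Num.bound Dsum); apply: le_lt_trans (archi_boundP _) => //.
    by do 4 (apply: sumr_ge0 => ? _).
  have := bnd N; apply/negP; rewrite -ltNge (lt_le_trans lt_N) //.
  by rewrite ler_peMr ?ler0n // exprn_ege1 // ler1n.
have term_le l l' j j' :
    normc (\sum_(i < N) zeta l l' j j' ^+ (N0.+1 + i)) <=
    (l == l')%:R * N%:R + (j == j')%:R * N%:R + D l l' j j'.
  have [zeta_1|zeta_ne1] := eqVneq (zeta l l' j j') 1; last first.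
    apply: le_trans (geometric_sum_bound _ _ (zeta1 _ _ _ _) zeta_ne1) _.
    by rewrite lerDr addr_ge0 ?mulr_ge0 ?ler0n.
  apply: le_trans (_ : N%:R <= _).
    apply: le_trans (normc_sum _ _ _) _; rewrite -[X in _ <= X%:R](card_ord N).
    rewrite -sumr_const; apply: ler_sum => i _.
    by rewrite normcX zeta1 expr1n.
  suff : (l == l') || (j == j').
    have N_ge0 : 0 <= N%:R :> R by rewrite ler0n.
    by move: (D0 l l' j j'); do 2 case: eqP => //= _; rewrite ?mul1r ?mul0r; lra.
  rewrite -[_ || _]negbK negb_or; apply/negP => /andP[nl nj].
  have := u_indep _ _ _ _ nj nl; apply/negP; rewrite negbK; apply/eqP.
  have uu j0 l0 : conjc (u j0 l0) * u j0 l0 = 1 by rewrite conjc_unit.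
  rewrite -[RHS]mul1r -zeta_1 /zeta rmorphM /= conjcK.
  transitivity (u j l * u j' l' * (conjc (u j' l) * u j' l) * (conjc (u j l') * u j l')).
    by rewrite !uu !mulr1.
  by ring.
pose S := \sum_(i < N) gram4 (fun j l => u j l ^+ (N0.+1 + i)).
have S_ge : N%:R * (3 * L%:R ^+ 3) <= S.
  rewrite mulr_natl -[X in _ *+ X](card_ord N) -sumr_const; apply: ler_sum => i _.
  by apply/ltW/gram4_large; lia.
have S_le : S <= \sum_l \sum_l' \sum_j \sum_j'
    normc (\sum_(i < N) zeta l l' j j' ^+ (N0.+1 + i)).
  have S_ge0 : 0 <= S.
    by apply: le_trans S_ge; rewrite !mulr_ge0 ?exprn_ge0 ?ler0n.
  rewrite -[S](ger0_norm S_ge0) -normc_real rmorph_sum /=.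
  under eq_bigr do rewrite gram4E.
  rewrite exchange_big; apply: le_trans (normc_sum _ _ _) _; apply: ler_sum => l _.
  rewrite exchange_big; apply: le_trans (normc_sum _ _ _) _; apply: ler_sum => l' _.
  rewrite exchange_big; apply: le_trans (normc_sum _ _ _) _; apply: ler_sum => j _.
  by rewrite exchange_big; apply: le_trans (normc_sum _ _ _) _.
have sum_diag (x : R) : \sum_(l < L) \sum_(l' < L) (l == l')%:R * x = L%:R * x.
  under eq_bigr => l _.
    rewrite (bigD1 l) //= eqxx mul1r big1 ?addr0; first over.
    by move=> l' /negPf; rewrite eq_sym => ->; rewrite mul0r.
  by rewrite sumr_const card_ord mulr_natl.
have S_le' : S <= L%:R * (L%:R * (L%:R * N%:R)) + L%:R * (L%:R * (L%:R * N%:R)) + Dsum.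
  apply: le_trans S_le _; apply: (@le_trans _ _ (\sum_l \sum_l' \sum_j \sum_j'
    ((l == l')%:R * N%:R + (j == j')%:R * N%:R + D l l' j j'))).
    by do 4 (apply: ler_sum => ? _).
  rewrite /Dsum le_eqVlt; apply/orP; left; apply/eqP.
  under eq_bigr => l _ do under eq_bigr => l' _ do under eq_bigr => j _ do
    rewrite !big_split /= sumr_const card_ord.
  under eq_bigr => l _ do under eq_bigr => l' _ do
    rewrite !big_split /= sumr_const card_ord sum_diag.
  under eq_bigr => l _ do rewrite !big_split /= sumr_const card_ord.
  rewrite !big_split /= sumr_const card_ord; congr (_ + _ + _); last first.
    by rewrite !mulr_natl.
  rewrite -sum_diag; apply: eq_bigr => l _; apply: eq_bigr => l' _.
  by rewrite !mulr_natl; ring.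
by nra.
Qed.

(** Paired with [h ^ n] at the points [z ^+ (j + l).+1] the weights give exactly [L ^ 2], since [h]
    is unimodular; paired with any monomial they give at most [L ^ 2 / Q]. *)
Lemma hankel_test (h : C -> C) p0 (e0 : R) k1 k2 Q N0 :
    disc_algebra h -> (forall z, normc z = 1 -> normc (h z) = 1) ->
    circle_close h p0 e0 -> k1 != k2 ->
    e0 < normc p0`_k1 -> e0 < normc p0`_k2 -> (0 < Q)%N ->
  exists L n z, [/\ (0 < L)%N, (N0 < n)%N, normc z = 1 &
    forall y, normc y = 1 -> Q%:R * normc (\sum_(j < L) \sum_(l < L)
      conjc (h (z ^+ (j + l).+1)) ^+ n * y ^+ (j + l).+1) <= L%:R ^+ 2].
Proof.
move=> hD h1 hp0 k12 pk1 pk2 Q_gt0.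
have [s [r [d [sr d_gt0 happ]]]] := two_leading_coefs hD hp0 k12 pk1 pk2.
(* With this [L], [L ^ 4 * (3 * L ^ 3)] is the fourth power of [9 * Q ^ 7], and [Q] times the latter
   is [L ^ 2]. *)
pose L := (3 * Q ^ 4)%N; have L_gt0 : (0 < L)%N by rewrite muln_gt0 expn_gt0 Q_gt0.
(* The cross differences for [j < j'] and [l < l'] are multiplied together, so that one [z] serves
   all of them; the shift by 1 keeps the smallest exponent positive. *)
pose F (q : 'I_L * 'I_L * ('I_L * 'I_L)) z :=
  h (z ^+ (q.1.1 + q.2.1).+1) * h (z ^+ (q.1.2 + q.2.2).+1) -
  h (z ^+ (q.1.2 + q.2.1).+1) * h (z ^+ (q.1.1 + q.2.2).+1).
pose P (q : 'I_L * 'I_L * ('I_L * 'I_L)) := (q.1.1 < q.1.2)%N && (q.2.1 < q.2.2)%N.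
have [|z z1] := @leading_coef_bounded_below_neq0 _ (fun z => \prod_(q | P q) F q z).
  apply: leading_coef_bounded_below_prod => q /andP[lt1 lt2].
  by apply: (cross_difference_leading sr d_gt0) happ; lia.
move=> /prodf_neq0 indep.
have zX m : normc (z ^+ m) = 1 by rewrite normcX z1 expr1n.
pose u (j l : 'I_L) := conjc (h (z ^+ (j + l).+1)).
have u1 j l : normc (u j l) = 1 by rewrite normc_conj h1.
have u_indep j j' l l' : j != j' -> l != l' -> u j l * u j' l' != u j' l * u j l'.
  rewrite /u -!rmorphM (inj_eq (can_inj (@conjcK R))).
  wlog lt_j : j j' / (j < j')%N => [th ne_j ne_l|].
    have [lt_j|lt_j|/val_inj eq_j] := ltngtP j j'; first exact: th.
    - by rewrite eq_sym th // eq_sym.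
    - by rewrite eq_j eqxx in ne_j.
  wlog lt_l : l l' / (l < l')%N => [th ne_j ne_l|_ _].
    have [lt_l|lt_l|/val_inj eq_l] := ltngtP l l'; first exact: th.
    - by rewrite [X in _ != X]mulrC eq_sym [X in _ != X]mulrC th // eq_sym.
    - by rewrite eq_l eqxx in ne_l.
  by have := indep ((j, j'), (l, l')); rewrite /P /= lt_j lt_l subr_eq0 => /(_ isT).
have [n lt_n le_n] := gram4_powers_small N0 L_gt0 u1 u_indep.
exists L, n, z; split=> // y y1.
have := @bilinear_gram4 _ (fun j l => u j l ^+ n) (fun j => y ^+ j.+1) (fun l => y ^+ l).
set T := normc _ => /(_ _ _)T4.
set T' := normc _; have -> : T' = T.
  by congr normc; apply: eq_bigr => j _; apply: eq_bigr => l _; rewrite -exprD addSn.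
have {}T4 : T ^+ 4 <= (9 * Q%:R ^+ 7) ^+ 4.
  apply: le_trans (T4 _ _) _ => [j|l|]; rewrite ?normcX ?y1 ?expr1n //.
  apply: le_trans (ler_wpM2l (exprn_ge0 _ (ler0n _ _)) le_n) _.
  by rewrite /L natrM natrX le_eqVlt; apply/orP; left; apply/eqP; ring.
have {}T4 : T <= 9 * Q%:R ^+ 7.
  rewrite -(@ler_pXn2r _ 4) // nnegrE ?normc_ge0 //.
  by rewrite mulr_ge0 ?exprn_ge0 ?ler0n.
apply: le_trans (ler_wpM2l (ler0n _ _) T4) _.
by rewrite /L natrM natrX le_eqVlt; apply/orP; left; apply/eqP; ring.
Qed.

End HankelTest.

(** * Restriction to one-parameter curves *)

Section Slices.
Variable R : realType.
Local Notation C := R[i].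
Implicit Types (z : cseq R) (a : mindex -> C) (f g : cseq R -> C) (al be ga : mindex).

Lemma big_fset_range (T : Type) (idx : T) (op : Monoid.com_law idx)
    (S : {fset nat}) D (F : nat -> T) :
    (forall j, j \in S -> (j < D)%N) -> (forall j, j \notin S -> F j = idx) ->
  \big[op/idx]_(j <- S) F j = \big[op/idx]_(j < D) F j.
Proof.
move=> SD F1; rewrite -(big_mkord xpredT F) /index_iota subn0.
rewrite [RHS](bigID (fun j => j \in S)) /= [X in op _ X]big1 // Monoid.mulm1.
rewrite -[RHS]big_filter; apply: perm_big.
apply: uniq_perm; rewrite ?fset_uniq ?filter_uniq ?iota_uniq // => j.
by rewrite mem_filter mem_iota add0n; case: (boolP (j \in S)) => // /SD ->.
Qed.

Lemma zpow_fset z al (S : {fset nat}) : (finsupp al `<=` S)%fset ->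
  zpow z al = \prod_(j <- S) z j ^+ al j.
Proof.
move=> sS; apply: big_fset_incl => // j _.
by rewrite memNfinsupp => /eqP ->; rewrite expr0.
Qed.

Lemma normc_zpow_le1 z al : in_polydisc z -> normc (zpow z al) <= 1.
Proof.
move=> z1; rewrite normc_prod; apply: prodr_ile1 => j.
by rewrite normc_ge0 normcX exprn_ile1 ?normc_ge0 // -normr_le1.
Qed.

Lemma normc_zpow_torus z al : in_torus z -> normc (zpow z al) = 1.
Proof.
move=> z1; rewrite normc_prod big1 // => j _.
by rewrite normcX in_torus_normc // expr1n.
Qed.

Definition weight N al := (\sum_(j <- finsupp al) N ^ j * al j)%N.

(* The curve along which distinct multi-indices with entries below [N] give
   distinct powers, by uniqueness of base [N] digits. *)
Definition slice N (x : C) : cseq R := fun j => x ^+ (N ^ j).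

Lemma zpow_slice N x al : zpow (slice N x) al = x ^+ weight N al.
Proof.
rewrite /zpow /slice /weight; elim: (finsupp al : seq nat) => [|j r IHr].
  by rewrite !big_nil.
by rewrite !big_cons IHr exprD exprM.
Qed.

Lemma slice_torus N x : normc x = 1 -> in_torus (slice N x).
Proof. by move=> x1 j; apply/normr_eq1; rewrite normcX x1 expr1n. Qed.

Lemma digits_inj N D (a b : nat -> nat) :
    (forall j, (a j < N)%N) -> (forall j, (b j < N)%N) ->
    (\sum_(j < D) N ^ j * a j = \sum_(j < D) N ^ j * b j)%N ->
  forall j, (j < D)%N -> a j = b j.
Proof.
elim: D a b => // D IHD a b aN bN.
have split_low (c : nat -> nat) : (\sum_(j < D.+1) N ^ j * c j =
    (\sum_(j < D) N ^ j * c j.+1) * N + c 0)%N.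
  rewrite big_ord_recl expn0 mul1n addnC; congr addn.
  by rewrite big_distrl; apply: eq_bigr => j _; rewrite lift0 expnS -mulnA mulnC.
rewrite !split_low => eq_ab.
have eq0 : a 0%N = b 0%N.
  by have := congr1 (modn^~ N) eq_ab; rewrite !modnMDl !modn_small.
have N_gt0 : (0 < N)%N := leq_ltn_trans (leq0n _) (aN 0%N).
case=> [|j] // lt_j; apply: (IHD (fun j => a j.+1) (fun j => b j.+1)) => //.
by apply/eqP; rewrite -(eqn_pmul2r N_gt0) -(eqn_add2r (a 0%N)) {2}eq0 eq_ab.
Qed.

Lemma weight_inj N al be : (forall j, (al j < N)%N) -> (forall j, (be j < N)%N) ->
  weight N al = weight N be -> al = be.
Proof.
move=> alN beN; pose D := (\max_(j <- (finsupp al `|` finsupp be)%fset) j).+1.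
have ltD j : j \in (finsupp al `|` finsupp be)%fset -> (j < D)%N.
  by move=> jS; rewrite ltnS (leq_bigmax_seq _ jS).
have weightE ga : (finsupp ga `<=` finsupp al `|` finsupp be)%fset ->
    weight N ga = (\sum_(j < D) N ^ j * ga j)%N.
  move=> sS; apply: big_fset_range => j; first by move/(fsubsetP sS)/ltD.
  by rewrite memNfinsupp => /eqP ->; rewrite muln0.
rewrite !weightE ?fsubsetUl ?fsubsetUr // => /(digits_inj alN beN) eq_al.
apply/fsfunP => j; have [/eq_al//|le_j] := ltnP j D.
have : j \notin (finsupp al `|` finsupp be)%fset.
  by apply: contraTN le_j => /ltD; rewrite -ltnNge.
by rewrite inE negb_or !memNfinsupp => /andP[/eqP-> /eqP->].
Qed.

Lemma is_coeffsP a f : is_coeffs a f <-> (exists M, sumbound a M) /\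
  forall z, in_polydisc z -> hsum (fun al => a al * zpow z al) (f z).
Proof.
split=> -[/abs_summableP a_sum f_sum]; split=> // z /f_sum.
  by move/has_sumP.
by move=> ?; apply/has_sumP.
Qed.

Lemma is_coeffs_uniform a f : is_coeffs a f ->
  forall e, 0 < e -> exists S0 : {fset mindex}, forall S : {fset mindex},
    (S0 `<=` S)%fset -> forall z, in_polydisc z ->
    normc (f z - \sum_(al <- S) a al * zpow z al) <= e.
Proof.
move=> /is_coeffsP[[M bnd] f_sum] e /(hsum_uniform bnd)[S0 close].
exists S0 => S sS z z1; apply: close => // [al|]; last exact: f_sum.
exact: normc_zpow_le1.
Qed.

Definition slice_poly a N (S : {fset mindex}) : {poly C} :=
  \sum_(al <- S) a al *: 'X^(weight N al).

Lemma is_coeffs_slice a f : is_coeffs a f ->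
  forall e, 0 < e -> exists S0 : {fset mindex}, forall (S : {fset mindex}) N,
    (S0 `<=` S)%fset -> circle_close (fun x => f (slice N x)) (slice_poly a N S) e.
Proof.
move=> f_sum e /(is_coeffs_uniform f_sum)[S0 close]; exists S0 => S N sS x x1.
rewrite horner_sum; under eq_bigr do rewrite hornerZ hornerXn -zpow_slice.
by apply: close => //; apply/in_torus_polydisc/slice_torus.
Qed.

Lemma slice_disc_algebra a f N : is_coeffs a f ->
  disc_algebra (fun x => f (slice N x)).
Proof.
move=> f_sum e /(is_coeffs_slice f_sum)[S0 close].
by exists (slice_poly a N S0); apply: close.
Qed.

(** A base [N] beyond all entries of the multi-indices in a finite set [S] makes the weights
    distinct on [S], so [slice_poly a N S] carries the coefficients of [a] unmerged. *)
Lemma separating_slice a f al be : is_coeffs a f -> a al != 0 -> a be != 0 ->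
  exists N p (e : R), [/\ circle_close (fun x => f (slice N x)) p e,
    e < normc p`_(weight N al), e < normc p`_(weight N be) &
    al != be -> weight N al != weight N be].
Proof.
move=> f_sum al0 be0; pose m := Num.min (normc (a al)) (normc (a be)).
have m0 : 0 < m by rewrite lt_min !normc_gt0 al0.
have e0 : 0 < m / 2 by lra.
have [S0 close] := is_coeffs_slice f_sum e0.
pose S := (S0 `|` [fset al; be])%fset.
pose N := (\sum_(ga <- S) \sum_(j <- finsupp ga) ga j).+1.
have ltN ga j : ga \in S -> (ga j < N)%N.
  move=> gaS; rewrite ltnS (big_fsetD1 ga) //=.
  have [j_ga|] := boolP (j \in finsupp ga); last first.
    by rewrite memNfinsupp => /eqP ->.
  by rewrite (big_fsetD1 j) //= -addnA leq_addr.
have coefS ga : ga \in S -> (slice_poly a N S)`_(weight N ga) = a ga.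
  move=> gaS; rewrite coef_sum (big_fsetD1 ga) //= coefZ coefXn eqxx mulr1.
  rewrite big_seq big1 ?addr0 // => ga'; rewrite !inE => /andP[ne_ga ga'S].
  rewrite coefZ coefXn; case: eqP => [/weight_inj eq_ga|]; last by rewrite mulr0.
  by case/eqP: ne_ga; rewrite eq_ga // => j; apply: ltN; rewrite // !inE.
have alS : al \in S by rewrite !inE eqxx orbT.
have beS : be \in S by rewrite !inE eqxx !orbT.
exists N, (slice_poly a N S), (m / 2); split.
- by apply: close; apply: fsubsetUl.
- rewrite coefS //; have : m <= normc (a al) by rewrite ge_min lexx.
  by move: e0; lra.
- rewrite coefS //; have : m <= normc (a be) by rewrite ge_min lexx orbT.
  by move: e0; lra.
by apply: contraNneq => /weight_inj ->  // j; apply: ltN.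
Qed.

(** A non-zero coefficient would show up, beyond the error, in an approximant of some slice, against
    [cauchy_estimate]. This is uniqueness of expansions, for the zero function. *)
Lemma is_coeffs_eq0 a f al :
  is_coeffs a f -> (forall z, in_polydisc z -> f z = 0) -> a al = 0.
Proof.
move=> f_sum f0; apply/eqP/negPn/negP => al0.
have [N [p [e [close lt_e _ _]]]] := separating_slice f_sum al0 al0.
move: lt_e; rewrite ltNge => /negP; apply; apply: cauchy_estimate => x x1.
have := close x x1; rewrite f0 ?sub0r ?normc_sub //.
exact/in_torus_polydisc/slice_torus.
Qed.

Lemma torus_test a g al be Q N0 :
    is_coeffs a g -> (forall z, in_torus z -> normc (g z) = 1) ->
    a al != 0 -> a be != 0 -> al != be -> (0 < Q)%N ->
  exists n (T : finType) (pt : T -> cseq R), [/\ (N0 < n)%N, (0 < #|T|)%N,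
    forall t, in_torus (pt t) & forall ga, Q%:R *
      normc (\sum_t conjc (g (pt t)) ^+ n * zpow (pt t) ga) <= #|T|%:R].
Proof.
move=> g_sum g1 al0 be0 al_be Q_gt0.
have [N [p [e [close lt_al lt_be /(_ al_be) ne_w]]]] := separating_slice g_sum al0 be0.
have [|L [n [x [L_gt0 lt_n x1 test]]]] := hankel_test N0
  (slice_disc_algebra N g_sum) _ close ne_w lt_al lt_be Q_gt0.
  by move=> x x1; apply/g1/slice_torus.
have xX k : normc (x ^+ k) = 1 by rewrite normcX x1 expr1n.
exists n, ('I_L * 'I_L)%type, (fun t : 'I_L * 'I_L => slice N (x ^+ (t.1 + t.2).+1)); split=> //.
- by rewrite card_prod card_ord muln_gt0 L_gt0.
- by move=> t; apply: slice_torus.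
move=> ga; rewrite card_prod card_ord natrM -expr2.
(* Along the slice the monomial of index [ga] becomes the power [weight N ga], so the test at
   [y = x ^+ weight N ga] covers it. *)
apply: le_trans (test (x ^+ weight N ga) (xX _)).
rewrite le_eqVlt; apply/orP; left; apply/eqP; congr (_ * normc _).
rewrite pair_big /=; apply: eq_bigr => t _.
by rewrite zpow_slice -!exprM mulnC.
Qed.

(** The functional with nodes [pt] and weights [w] is at most [tau] on monomials, hence at most
    [M * tau] on finite parts of the expansion of [f]; the remainder is uniformly small. *)
Lemma functional_bound a f M (T : finType) (pt : T -> cseq R) (w : T -> C) (tau : R) :
    is_coeffs a f -> sumbound a M -> (forall t, in_torus (pt t)) ->
    (forall ga, normc (\sum_t w t * zpow (pt t) ga) <= tau) ->
  normc (\sum_t w t * f (pt t)) <= M * tau.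
Proof.
move=> f_sum bnd pt1 le_tau; apply/ler_addgt0Pr => e e_gt0.
pose W := \sum_t normc (w t) + 1.
have W0 : 0 < W by rewrite ltr_wpDl // sumr_ge0 // => t _; apply: normc_ge0.
have [S close] := is_coeffs_uniform f_sum (divr_gt0 e_gt0 W0).
have tau0 := le_trans (normc_ge0 _) (le_tau [fsfun]).
have -> : \sum_t w t * f (pt t) =
    \sum_(ga <- S) a ga * (\sum_t w t * zpow (pt t) ga) +
    \sum_t w t * (f (pt t) - \sum_(ga <- S) a ga * zpow (pt t) ga).
  under [in RHS]eq_bigr do rewrite mulr_sumr.
  rewrite exchange_big -big_split /=; apply: eq_bigr => t _.
  rewrite mulrBr mulr_sumr addrC -[LHS]addr0 -addrA; congr (_ + _).
  apply/eqP; rewrite eq_sym addrC subr_eq0; apply/eqP.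
  by apply: eq_bigr => ga _; ring.
apply: le_trans (normcD _ _) (lerD _ _).
  apply: le_trans (normc_sum _ _ _) _.
  apply: le_trans (ler_wpM2r tau0 (bnd S)); rewrite mulr_suml.
  by apply: ler_sum => ga _; rewrite normcM ler_wpM2l ?normc_ge0.
apply: le_trans (normc_sum _ _ _) _.
apply: (@le_trans _ _ (\sum_t normc (w t) * (e / W))).
  apply: ler_sum => t _; rewrite normcM ler_wpM2l ?normc_ge0 //.
  by apply: close => //; apply: in_torus_polydisc.
rewrite -mulr_suml mulrA ler_pdivrMr // mulrC ler_wpM2l ?ltW //.
by rewrite /W ltrDl.
Qed.

End Slices.

(** * The gliding hump *)

Section GlidingHump.
Variable R : realType.
Local Notation C := R[i].
Implicit Types (z : cseq R) (a : mindex -> C) (f g : cseq R -> C).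

Definition mono i n : mindex := [fsfun j in [fset i]%fset => n | 0%N].

Lemma monoE i n : mono i n i = n.
Proof. by rewrite fsfunE inE eqxx. Qed.

Lemma zpow_mono z i n : zpow z (mono i n) = z i ^+ n.
Proof.
by rewrite (zpow_fset _ (finsupp_sub _ _ _)) big_seq_fset1 monoE.
Qed.

Lemma is_coeffs_polynomial a (S : {fset mindex}) :
    (forall al, al \notin S -> a al = 0) ->
  is_coeffs a (fun z => \sum_(al <- S) a al * zpow z al).
Proof.
move=> a0; apply/is_coeffsP; split=> [|z _].
  exists (\sum_(al <- S) normc (a al)) => F; rewrite (big_fsetID _ (mem S)) /=.
  rewrite [X in _ + X]big_seq [X in _ + X]big1 ?addr0; last first.
    by move=> al; rewrite !inE => /andP[_ /a0 ->]; rewrite normc0.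
  rewrite [leRHS](big_fsetID _ (mem F)) /= addrC ler_wpDl ?sumr_ge0 //.
    by move=> al _; apply: normc_ge0.
  rewrite le_eqVlt; apply/orP; left; apply/eqP; apply: eq_fbigl => al.
  by rewrite !inE andbC.
by apply: hsum_finite => al /a0 ->; rewrite mul0r.
Qed.

Lemma coordinate_power_Aplus i n : in_Aplus (fun z : cseq R => z i ^+ n).
Proof.
pose a al : C := (al == mono i n)%:R; exists a.
rewrite (_ : (fun z => _) = fun z => \sum_(al <- [fset mono i n]%fset) a al * zpow z al).
  by apply: is_coeffs_polynomial => al; rewrite inE /a => /negPf ->.
by apply/funext => z; rewrite big_seq_fset1 /a eqxx mul1r zpow_mono.
Qed.

Lemma pushforward_exists (K J : choiceType) (e : K -> J) (b : K -> C) :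
  injective e ->
  exists2 G : J -> C, forall k, G (e k) = b k & forall j, (forall k, j <> e k) -> G j = 0.
Proof.
move=> e_inj.
have : forall j, exists y, (forall k, j = e k -> y = b k) /\
    ((forall k, j <> e k) -> y = 0).
  move=> j; have [[k ->]|nex] := pselect (exists k, j = e k).
    exists (b k); split=> [k' /e_inj -> //|/(_ k)//].
  by exists 0; split=> // k jk; case: nex; exists k.
case/choice => G GP; exists G => [k|j]; first by have [/(_ k erefl)] := GP (e k).
by have [_] := GP j.
Qed.

(** As [m] is injective, the powers of [z i] occupy distinct multi-indices, and [b] extends by zero
    to a coefficient family on [mindex]. *)
Lemma coordinate_series_Aplus i (m : nat -> nat) (b : nat -> C) M :
    injective m -> sumbound b M ->
  exists2 f, in_Aplus f &
    forall z, in_polydisc z -> hsum (fun k => b k * z i ^+ m k) (f z).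
Proof.
move=> m_inj bnd; pose e k := mono i (m k).
have e_inj : injective e by move=> k l /(congr1 (fun al : mindex => al i)); rewrite !monoE => /m_inj.
have sum_ex z : exists s, in_polydisc z -> hsum (fun k => b k * z i ^+ m k) s.
  (* Off the polydisc, where the series may diverge, the function is given the value 0. *)
  have [z1|nz1] := pselect (in_polydisc z); last by exists 0.
  have [|s sum_s] := @summable_hsum _ _ (fun k => b k * z i ^+ m k) M.
    move=> F; apply: le_trans (bnd F); apply: ler_sum => k _.
    rewrite normcM ler_piMr ?normc_ge0 // normcX exprn_ile1 ?normc_ge0 //.
    by rewrite -normr_le1.
  by exists s.
have [f f_sum] := choice sum_ex; exists f => //.
have [a ae a0] := pushforward_exists b e_inj; exists a; apply/is_coeffsP; split.
  by exists M; apply: (sumbound_pushforward e_inj ae a0).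
move=> z z1; apply: (hsum_pushforward e_inj _ _ (f_sum z z1)) => [k|al /a0 ->].
  by rewrite ae zpow_mono.
by rewrite mul0r.
Qed.

Lemma in_fset_iota k N : (k \in [fset j in iota 0 N]%fset) = (k < N)%N.
Proof. by rewrite !inE mem_iota. Qed.

Lemma sum_fset_iota (V : zmodType) (f : nat -> V) N :
  \sum_(k <- [fset k in iota 0 N]%fset) f k = \sum_(k < N) f k.
Proof.
rewrite -(big_mkord xpredT f) /index_iota subn0; apply: perm_big.
by apply: uniq_perm; rewrite ?fset_uniq ?iota_uniq // => k; rewrite !inE.
Qed.

Lemma hsum_partial_sums (f : nat -> C) s : hsum f s ->
  forall e, 0 < e -> exists N0, forall N, (N0 <= N)%N ->
    normc (s - \sum_(k < N) f k) < e.
Proof.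
move=> sum_s e /sum_s[F0 close]; exists (\max_(k <- F0) k).+1 => N le_N.
rewrite -sum_fset_iota; apply: close; apply/fsubsetP => k kF0.
by rewrite in_fset_iota (leq_trans _ le_N) // ltnS (leq_bigmax_seq _ kF0).
Qed.

(** With ratio 1/4 the terms beyond [k] add up to a third of the bound at [k], so in the gliding
    hump one term outweighs all later ones. *)
Lemma quarter_series_tail (f : nat -> C) s k :
    (forall j, normc (f j) <= 4^-1 ^+ j) -> hsum f s ->
  normc (s - \sum_(i < k.+1) f i) <= 4^-1 ^+ k / 3.
Proof.
move=> f_le sum_s; apply/ler_addgt0Pr => e /(hsum_partial_sums sum_s)[N0 close].
pose b i : R := 4^-1 ^+ i.
have tail j : normc (\sum_(i < k.+1 + j) f i - \sum_(i < k.+1) f i) <=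
    (b k - b (k + j)%N) / 3.
  elim: j => [|j IHj]; first by rewrite !addn0 !subrr normc0 mul0r.
  rewrite addnS [X in X - _]big_ord_recr /= addrAC.
  apply: le_trans (normcD _ _) _; have := f_le (k.+1 + j)%N.
  rewrite addSn -/(b _) (_ : b (k + j).+1 = 4^-1 * b (k + j)%N); last by rewrite /b exprS.
  rewrite (_ : b (k + j.+1)%N = 4^-1 * b (k + j)%N); last by rewrite /b addnS exprS.
  by move: IHj; rewrite addSn; lra.
have := tail N0; have := close (k.+1 + N0)%N (leq_addl _ _).
have b0 : 0 <= b (k + N0)%N by rewrite exprn_ge0 // invr_ge0.
move: (\sum_(i < _ + _) _) => x lt_e le_x.
rewrite (_ : s - _ = s - x + (x - \sum_(i < k.+1) f i)); last by ring.
by apply: le_trans (normcD _ _) _; rewrite -/(b k); lra.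
Qed.

Lemma sumbound_quarter : sumbound (fun k => (4^-1 ^+ k : R)%:C%C) 2.
Proof.
move=> F; pose N := (\max_(k <- F) k).+1.
have sF : (F `<=` [fset k in iota 0 N])%fset.
  apply/fsubsetP => k kF; rewrite in_fset_iota ltnS.
  by rewrite (leq_bigmax_seq _ kF).
have b0 k : 0 <= 4^-1 ^+ k :> R by rewrite exprn_ge0 // invr_ge0.
under eq_bigr do rewrite normc_real ger0_norm //.
have partial n : \sum_(k < n) 4^-1 ^+ k <= 2 - 2 * 4^-1 ^+ n :> R.
  elim: n => [|n IHn]; first by rewrite big_ord0 expr0; lra.
  by rewrite big_ord_recr exprS /=; have := b0 n; lra.
apply: (@le_trans _ _ (\sum_(k < N) 4^-1 ^+ k)); last first.
  by have := partial N; have := b0 N; lra.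
by rewrite -(sum_fset_iota (fun k => 4^-1 ^+ k)) (sum_fset_sub _ sF) lerDl sumr_ge0.
Qed.

(* The exponents [m k] are chosen in turn, each test being strong enough to
   dominate the norms of the powers already chosen. *)
Lemma gliding_hump g :
    (forall z, in_torus z -> normc (g z) = 1) ->
    (forall n, in_Aplus (fun z => g z ^+ n)) ->
    (forall m : nat -> nat, injective m -> exists2 G, in_Aplus G &
      forall z, in_torus z -> hsum (fun k => (4^-1 ^+ k : R)%:C%C * g z ^+ m k) (G z)) ->
  ~ (forall Q N0, (0 < Q)%N ->
      exists n (T : finType) (pt : T -> cseq R), [/\ (N0 < n)%N, (0 < #|T|)%N,
        forall t, in_torus (pt t) & forall ga, Q%:R *
        normc (\sum_t conjc (g (pt t)) ^+ n * zpow (pt t) ga) <= #|T|%:R]).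
Proof.
move=> g1 g_pow g_series tests; pose b k : R := 4^-1 ^+ k.
have b_gt0 k : 0 < b k by rewrite exprn_gt0 // invr_gt0.
have [K KP] : exists K : nat -> R, forall n, exists2 c,
    is_coeffs c (fun z => g z ^+ n) & sumbound c (K n).
  have /choice[K KP] : forall n, exists M, exists2 c,
      is_coeffs c (fun z => g z ^+ n) & sumbound c M.
    move=> n; have [c c_sum] := g_pow n.
    by have /is_coeffsP[[M bnd] _] := c_sum; exists M, c.
  by exists K.
have K0 n : 0 <= K n by have [c _ /sumbound_ge0] := KP n.
have [next nextP] : exists next : nat * nat -> nat, forall q,
    exists (T : finType) (pt : T -> cseq R), [/\ (q.2 < next q)%N, (0 < #|T|)%N,
      forall t, in_torus (pt t) & forall ga, q.1.+1%:R *
      normc (\sum_t conjc (g (pt t)) ^+ next q * zpow (pt t) ga) <= #|T|%:R].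
  by have /choice[next P] := fun q : nat * nat => tests q.1.+1 q.2 isT; exists next.
(* Strength of test [k], with [P] bounding the norm of the terms already chosen: [b k] times the
   strength must exceed [2 * (k + P)]. The state [st] holds this [P] and the last exponent. *)
pose Qof k (P : R) := Num.bound ((b k)^-1 * 2 * (k%:R + P)).
pose step k (st : R * nat) := let n := next (Qof k st.1, st.2) in (st.1 + b k * K n, n).
pose st := fix st k := if k is k'.+1 then step k' (st k') else (0, 0%N).
pose m k := (st k.+1).2; pose P k := (st k).1.
have PE k : P k = \sum_(i < k) b i * K (m i).
  by elim: k => [|k IHk]; rewrite ?big_ord0 // big_ord_recr /= -IHk.
have P0 k : 0 <= P k.
  by rewrite PE sumr_ge0 // => i _; rewrite mulr_ge0 // ltW.
have m_test k := nextP (Qof k (P k), (st k).2).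
have m_lt : {homo m : k l / (k < l)%N >-> (k < l)%N}.
  apply: homo_ltn => [x y w|k]; first exact: ltn_trans.
  by have [T [pt []]] := m_test k.+1.
have m_inj : injective m.
  by move=> k l eq_m; case: (ltngtP k l) => // /m_lt; rewrite eq_m ltnn.
have [G [c c_sum] G_series] := g_series m m_inj.
have /is_coeffsP[[M bnd] _] := c_sum.
(* [M] bounds the norm of [G]; any test of index [k > M] refutes this bound. *)
have [k lt_M] : exists k : nat, M < k%:R.
  by exists (Num.bound M); apply/archi_boundP/(sumbound_ge0 bnd).
have [T [pt [_ T_gt0 pt1]]] := m_test k; rewrite -/(m k) /= => test.
set Q := (Qof k (P k)).+1%:R in test.
have Q_gt0 : 0 < Q by rewrite ltr0n.
have Q_large : 2 * (k%:R + P k) < b k * Q.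
  have : (b k)^-1 * 2 * (k%:R + P k) < Q.
    apply: lt_trans (archi_boundP _) _; last by rewrite ltr_nat.
    have b_inv : 0 <= (b k)^-1 by rewrite invr_ge0 ltW.
    by apply: mulr_ge0; [apply: mulr_ge0 | apply: addr_ge0]; rewrite ?ler0n.
  by rewrite -mulrA ltr_pdivrMl.
pose card : R := #|T|%:R; have card_gt0 : 0 < card by rewrite ltr0n.
pose w t := conjc (g (pt t)) ^+ m k.
have w1 t : normc (w t) = 1 by rewrite normcX normc_conj g1 ?expr1n.
have w_test ga : normc (\sum_t w t * zpow (pt t) ga) <= card / Q.
  by rewrite ler_pdivlMr // mulrC test.
have boundG := functional_bound c_sum bnd pt1 w_test.
have bound_pow i : normc (\sum_t w t * g (pt t) ^+ m i) <= K (m i) * (card / Q).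
  have [a a_sum a_bnd] := KP (m i).
  exact: (functional_bound a_sum a_bnd pt1 w_test).
pose f t j : C := (b j)%:C%C * g (pt t) ^+ m j.
have tail t : normc (G (pt t) - \sum_(i < k.+1) f t i) <= b k / 3.
  apply: quarter_series_tail => [j|]; last exact: G_series.
  by rewrite normcM normcX g1 // expr1n mulr1 normc_real ger0_norm // ltW.
have main : \sum_t w t * f t k = (b k * card)%:C%C.
  transitivity (\sum_(t : T) (b k)%:C%C).
    apply: eq_bigr => t _; rewrite /w /f mulrCA -exprMn conjc_unit ?g1 //.
    by rewrite expr1n mulr1.
  by rewrite sumr_const -mulr_natr rmorphM /= rmorph_nat.
(* Term [k] is [G] minus the earlier terms and the tail. The functional is [b k * card] on it, small
   on [G] and the earlier terms by the test, and at most a third of [b k * card] on the tail. *)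
have : (b k * card)%:C%C = \sum_t w t * G (pt t)
    - \sum_(i < k) (b i)%:C%C * (\sum_t w t * g (pt t) ^+ m i)
    - \sum_t w t * (G (pt t) - \sum_(i < k.+1) f t i).
  have -> : \sum_(i < k) (b i)%:C%C * (\sum_t w t * g (pt t) ^+ m i) =
      \sum_t w t * \sum_(i < k) f t i.
    under eq_bigr do rewrite mulr_sumr.
    rewrite exchange_big /=; apply: eq_bigr => t _; rewrite mulr_sumr.
    by apply: eq_bigr => i _; rewrite /f mulrCA.
  rewrite -main -!sumrB; apply: eq_bigr => t _.
  by rewrite big_ord_recr /=; ring.
move/(congr1 (@normc R)); rewrite normc_real ger0_norm; last first.
  by rewrite mulr_ge0 // ltW.
move=> eq_b; have : b k * card <= M * (card / Q) + P k * (card / Q) + card * (b k / 3).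
  rewrite eq_b; apply: le_trans (normcB _ _) (lerD _ _).
    apply: le_trans (normcB _ _) (lerD boundG _).
    apply: le_trans (normc_sum _ _ _) _; rewrite PE mulr_suml.
    apply: ler_sum => i _; rewrite normcM normc_real ger0_norm ?(ltW (b_gt0 i)) //.
    by rewrite -mulrA ler_wpM2l // ltW.
  apply: le_trans (normc_sum _ _ _) _; rewrite mulr_natl -sumr_const.
  by apply: ler_sum => t _; rewrite normcM w1 mul1r.
have -> : M * (card / Q) + P k * (card / Q) + card * (b k / 3) =
    card * ((M + P k) / Q + b k / 3) by ring.
rewrite mulrC ler_pM2l // => le_b.
(* With [Q_large] this gives [4 / 3 * (k + P k) < M + P k], impossible as [M < k]. *)
have : b k * Q * (2 / 3) <= M + P k.
  rewrite mulrAC -ler_pdivlMr //; move: le_b.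
  by move: (b k) (_ / Q) => x y; lra.
have k0 : 0 <= k%:R :> R by rewrite ler0n.
by have := P0 k; lra.
Qed.

End GlidingHump.

(** * Monomial maps *)

Section MonomialMaps.
Variable R : realType.
Local Notation C := R[i].
Implicit Types (z : cseq R) (al be ga : mindex).

(** Two non-zero coefficients of [g] contradict [gliding_hump], whose tests come from [torus_test];
    having none contradicts [normc (g one) = 1]. Exactly one remains, and evaluating at [one] shows
    that it is unimodular. *)
Lemma coordinate_monomial (phi : cseq R -> cseq R) i :
    (forall f : cseq R -> C, in_Aplus f -> in_Aplus (comp_op phi f)) ->
    (forall z, in_polydisc z -> in_polydisc (phi z)) ->
    (forall z, in_torus z -> in_torus (phi z)) ->
  exists p : mindex * C, normc p.2 = 1 /\
    forall z, in_polydisc z -> phi z i = p.2 * zpow z p.1.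
Proof.
move=> phi_Aplus phi_disc phi_torus; pose g z := phi z i.
have g1 z : in_torus z -> normc (g z) = 1.
  by move=> /phi_torus z1; apply: in_torus_normc.
have g_pow n : in_Aplus (fun z => g z ^+ n).
  exact: phi_Aplus (coordinate_power_Aplus R i n).
have [c c_sum] := g_pow 1%N.
have {}c_sum : is_coeffs c g by [].
have single al be : c al != 0 -> c be != 0 -> al = be.
  move=> al0 be0; apply/eqP/negPn/negP => al_be.
  apply: (gliding_hump g1 g_pow) => [m m_inj|Q N0 Q_gt0]; last first.
    exact: torus_test c_sum g1 al0 be0 al_be Q_gt0.
  have [f f_Aplus f_sum] := coordinate_series_Aplus i m_inj (sumbound_quarter R).
  exists (comp_op phi f); first exact: phi_Aplus.
  by move=> z z1; apply/f_sum/phi_disc/in_torus_polydisc.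
have [_ g_sum] := (is_coeffsP c g).1 c_sum.
pose one : cseq R := fun=> 1; have one1 : in_torus one by move=> j; rewrite normr1.
have [al al0] : exists al, c al != 0.
  apply: contrapT => nex; have := g1 one one1.
  rewrite (hsum_unique (g_sum one (in_torus_polydisc one1)) (t := 0)).
    by rewrite normc0 => /eqP; rewrite eq_sym oner_eq0.
  have := @hsum_finite R _ (fun al => c al * zpow one al) fset0.
  rewrite big_seq_fset0; apply=> al _.
  have [->|al0] := eqVneq (c al) 0; first by rewrite mul0r.
  by case: nex; exists al.
have gE z : in_polydisc z -> g z = c al * zpow z al.
  move=> z1; apply: hsum_unique (g_sum z z1) _.
  have := @hsum_finite R _ (fun al => c al * zpow z al) [fset al]%fset.
  rewrite big_seq_fset1; apply=> be; rewrite inE => /eqP ne_be.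
  have [->|be0] := eqVneq (c be) 0; first by rewrite mul0r.
  by case: ne_be; apply: single.
exists (al, c al); split=> //=; rewrite -(g1 one one1) gE ?normcM.
  by rewrite normc_zpow_torus // mulr1.
exact: in_torus_polydisc.
Qed.

(** * The action of a monomial map on multi-indices *)

Variables (A : nat -> mindex) (eps : nat -> C).

(** [Astar] on non-negative indices: only finitely many rows enter, and the union of their supports
    is finite, so the value is again a [mindex]. *)
Definition index_map al : mindex :=
  [fsfun j in (\bigcup_(i <- finsupp al) finsupp (A i))%fset =>
     (\sum_(i <- finsupp al) A i j * al i)%N | 0%N].

Lemma index_mapE al j : index_map al j = (\sum_(i <- finsupp al) A i j * al i)%N.
Proof.
rewrite fsfunE; case: ifPn => // /bigfcupP nj.
rewrite big_seq big1 // => i i_al; have [Aij|] := boolP (j \in finsupp (A i)).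
  by case: nj; exists i; rewrite // i_al.
by rewrite memNfinsupp => /eqP ->.
Qed.

Lemma index_map_fset al j (S : {fset nat}) : (finsupp al `<=` S)%fset ->
  (index_map al j)%:Z = \sum_(i <- S) (A i j)%:Z * (al i)%:Z.
Proof.
move=> sS; rewrite index_mapE -(big_fset_incl _ sS); last first.
  by move=> i _; rewrite memNfinsupp => /eqP ->; rewrite mulr0.
by elim/big_rec2: _ => // i x y _ <-.
Qed.

Lemma Astar_fset (x : zindex) j (S : {fset nat}) : (finsupp x `<=` S)%fset ->
  Astar A x j = \sum_(i <- S) (A i j)%:Z * x i.
Proof.
move=> sS; apply: (big_fset_incl _ sS) => i _.
by rewrite memNfinsupp => /eqP ->; rewrite mulr0.
Qed.

Definition phase al : C := \prod_(i <- finsupp al) eps i ^+ al i.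

Lemma normc_phase al : (forall i, normc (eps i) = 1) -> normc (phase al) = 1.
Proof.
by move=> eps1; rewrite normc_prod big1 // => i _; rewrite normcX eps1 expr1n.
Qed.

Lemma zpow_monomial_map z w al : (forall i, w i = eps i * zpow z (A i)) ->
  zpow w al = phase al * zpow z (index_map al).
Proof.
move=> wE; pose S := (\bigcup_(i <- finsupp al) finsupp (A i))%fset.
have -> : zpow z (index_map al) = \prod_(i <- finsupp al) zpow z (A i) ^+ al i.
  rewrite (@zpow_fset _ z _ S) ?finsupp_sub //.
  under eq_bigr do rewrite index_mapE expr_sum.
  rewrite exchange_big /= !big_seq; apply: eq_bigr => i i_al.
  have sub : (finsupp (A i) `<=` S)%fset by apply: bigfcup_sup.
  by rewrite (zpow_fset _ sub) -prodrXl; apply: eq_bigr => j _; rewrite exprM.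
by rewrite /phase -big_split; apply: eq_bigr => i _; rewrite wE exprMn.
Qed.

Definition zindex_of al : zindex := [fsfun j in finsupp al => (al j)%:Z | 0%Z].

Lemma zindex_ofE al j : zindex_of al j = (al j)%:Z.
Proof. by rewrite fsfunE; case: finsuppP. Qed.

Lemma Astar_zindex_of al j : Astar A (zindex_of al) j = (index_map al j)%:Z.
Proof.
rewrite (Astar_fset _ (finsupp_sub _ _ _)) (index_map_fset _ (fsubset_refl _)).
by apply: eq_bigr => i _; rewrite zindex_ofE.
Qed.

Lemma index_map_inj : injective (Astar A) -> injective index_map.
Proof.
move=> A_inj al be eq_al; have eq_Z : zindex_of al = zindex_of be.
  by apply: A_inj; apply/funext => j; rewrite !Astar_zindex_of eq_al.
apply/fsfunP => j; have := congr1 (fun x : zindex => x j) eq_Z.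
by rewrite !zindex_ofE => -[].
Qed.

(* Shifting both arguments by [|x| + |y|] makes them non-negative. *)
Lemma Astar_collision (x y : zindex) : Astar A x = Astar A y -> x <> y ->
  exists al be, al != be /\ index_map al = index_map be.
Proof.
move=> eq_A ne_xy; pose S := (finsupp x `|` finsupp y)%fset.
pose sh j := (`|x j| + `|y j|)%N.
pose shift (u : zindex) : mindex := [fsfun j in S => `|(u j + (sh j)%:Z)%R|%N | 0%N].
have out j : j \notin S -> x j = 0 /\ y j = 0.
  by rewrite inE negb_or !memNfinsupp => /andP[/eqP-> /eqP->].
have shiftE u : u = x \/ u = y -> forall j, (shift u j)%:Z = u j + (sh j)%:Z.
  move=> ux j; rewrite fsfunE /sh; case: ifPn => [_|/out[xj yj]].
    by case: ux => ->; lia.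
  by case: ux => ->; rewrite ?xj ?yj.
have mapE u : u = x \/ u = y -> forall j, (index_map (shift u) j)%:Z =
    Astar A u j + \sum_(i <- S) (A i j)%:Z * (sh i)%:Z.
  move=> ux j; rewrite (index_map_fset _ (finsupp_sub _ _ _)) (Astar_fset _ (S := S)).
    by rewrite -big_split; apply: eq_bigr => i _; rewrite shiftE // mulrDr.
  by case: ux => ->; rewrite ?fsubsetUl ?fsubsetUr.
exists (shift x), (shift y); split.
  apply/eqP => eq_sh; apply: ne_xy; apply/fsfunP => j.
  apply: (addIr (sh j)%:Z); rewrite -!shiftE ?eq_sh //; by [left | right].
apply/fsfunP => j; have [] : (index_map (shift x) j)%:Z = (index_map (shift y) j)%:Z.
  by rewrite !mapE ?eq_A //; [right | left].
by [].
Qed.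

(** * Isometry of the composition operator and injectivity of the matrix *)

Hypothesis eps1 : forall i, normc (eps i) = 1.
Variable phi : cseq R -> cseq R.
Hypothesis phiE : forall i z, in_polydisc z -> phi z i = eps i * zpow z (A i).

Lemma zpow_phi z al : in_polydisc z ->
  zpow (phi z) al = phase al * zpow z (index_map al).
Proof. by move=> z1; apply: zpow_monomial_map => i; apply: phiE. Qed.

Lemma index_map_inj_isometry :
    (forall z, in_polydisc z -> in_polydisc (phi z)) ->
  injective index_map -> comp_isometry phi.
Proof.
move=> phi_disc inj f n [a [/is_coeffsP[[M bnd] f_sum] /has_sumP a_norm]].
have [G Ge G0] := pushforward_exists (fun al => a al * phase al) inj.
have normG al : normc (a al * phase al) = normc (a al).
  by rewrite normcM normc_phase // mulr1.
exists G; split.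
  apply/is_coeffsP; split=> [|z z1].
    exists M; apply: (sumbound_pushforward inj Ge G0) => F.
    by under eq_bigr do rewrite normG.
  apply: (hsum_pushforward inj _ _ (f_sum _ (phi_disc _ z1))) => [al|ga /G0 ->].
    by rewrite Ge zpow_phi // mulrA.
  by rewrite mul0r.
apply/has_sumP; apply: (hsum_pushforward inj _ _ a_norm) => [al|ga /G0 ->].
  by rewrite Ge !normr_normc normG.
by rewrite normr0.
Qed.

Lemma isometry_Astar_inj : comp_isometry phi -> injective (Astar A).
Proof.
move=> iso x y eq_A; apply: contrapT => /(Astar_collision eq_A)[al [be [ne_al eq_B]]].
(* The conjugate phases cancel those produced by [zpow_phi], so the two terms are sent to the same
   monomial with opposite signs. *)
pose a ga : C := if ga == al then conjc (phase al)
  else if ga == be then - conjc (phase be) else 0.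
pose S := [fset al; be]%fset.
have a_al : a al = conjc (phase al) by rewrite /a eqxx.
have a_be : a be = - conjc (phase be) by rewrite /a eq_sym (negPf ne_al) eqxx.
have aS ga : ga \notin S -> a ga = 0.
  by rewrite !inE negb_or /a => /andP[/negPf -> /negPf ->].
have sumS (F : mindex -> C) : \sum_(ga <- S) F ga = F al + F be.
  by rewrite big_fsetU1 ?big_seq_fset1 // inE.
have normS : Aplus_norm_is (fun z => \sum_(ga <- S) a ga * zpow z ga) 2.
  exists a; split; first exact: is_coeffs_polynomial.
  apply/has_sumP; rewrite (_ : 2%:C%C = \sum_(ga <- S) `|a ga|).
    by apply: hsum_finite => ga /aS ->; rewrite normr0.
  rewrite sumS a_al a_be normrN !normr_normc !normc_conj !normc_phase //.
  by rewrite -rmorphD.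
have [c [c_sum /has_sumP c_norm]] := iso _ _ normS.
(* Uniqueness of expansions makes every coefficient of the image vanish, so its norm is 0 rather
   than 2. *)
have c0 ga : c ga = 0.
  apply: (is_coeffs_eq0 _ c_sum) => z z1; rewrite /comp_op sumS a_al a_be.
  rewrite !zpow_phi // eq_B mulNr !mulrA !conjc_unit ?normc_phase //.
  by rewrite subrr.
have c_norm0 : hsum (fun ga => `|c ga|) 0.
  rewrite -[0 in X in hsum _ X](@big_seq_fset0 _ _ +%R mindex (fun ga => `|c ga|)).
  by apply: hsum_finite => ga _; rewrite c0 normr0.
by have /complexI/eqP := hsum_unique c_norm c_norm0; rewrite pnatr_eq0.
Qed.

End MonomialMaps.

Unset Implicit Arguments.

Theorem theorem20 (R : realType) (phi : cseq R -> cseq R)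
  (phi_disc : forall z, in_polydisc z -> in_polydisc (phi z))
  (phi_Aplus : forall f : cseq R -> R[i], in_Aplus f -> in_Aplus (comp_op phi f))
  (phi_torus : forall z, in_torus z -> in_torus (phi z)) :
  exists (A : nat -> mindex) (eps : nat -> R[i]),
    [/\ (forall i, `|eps i| = 1),
        (forall i z, in_polydisc z -> phi z i = eps i * zpow z (A i)) &
        (comp_isometry phi <-> injective (Astar A))].
Proof.
(* Row [i] of the matrix is the exponent of the only monomial in the expansion of coordinate [i];
   its finite support is part of the type [mindex]. *)
have [p pP] := choice (fun i => coordinate_monomial i phi_Aplus phi_disc phi_torus).
pose A i := (p i).1; pose eps i := (p i).2; exists A, eps.
have eps1 i : normc (eps i) = 1 by case: (pP i).
have phiE i z : in_polydisc z -> phi z i = eps i * zpow z (A i).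
  by case: (pP i) => _; apply.
split=> // [i|]; first exact/normr_eq1.
split; first exact (isometry_Astar_inj eps1 phiE).
by move=> /index_map_inj; apply: (index_map_inj_isometry eps1 phiE phi_disc).
Qed.
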